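(* Let $\mu,\nu$ be two translation-invariant probability measures on $\Omega$ and let $p\ge 1$. Then $$D_p(\nu,\mu)\ge D_\infty(\nu,\mu).$$ As a consequence, for all $p\ge1$, $$D_p(\nu,\mu)=D_\infty(\nu,\mu)=\bar d(\nu,\mu).$$
   Context: $S$ is a finite set, $d\ge1$, $\Omega=S^{\mathbb{Z}^d}$ with the product of discrete topologies and Borel $\sigma$-algebra; $\Lambda_n=[-n,n]^d\cap\mathbb{Z}^d$. Shifts: $(\tau_i\eta)_j=\eta_{j-i}$; a probability measure is translation invariant if it is invariant under all $\tau_i$. For finite nonempty $\Lambda\subset\mathbb{Z}^d$, $\mathrm{Loc}(\Omega_\Lambda)$ is the set of functions $f:\Omega\to\mathbb{R}$ depending only on the coordinates in $\Lambda$. Oscillations: $\delta_i f=\sup\{f(\sigma)-f(\tilde\sigma):\sigma_j=\tilde\sigma_j\ \forall j\neq i\}$; $\|\delta f\|_q=(\sum_{i}(\delta_i f)^q)^{1/q}$ for $q<\infty$ and $\|\delta f\|_\infty=\sup_i\delta_i f$. With $q$ the conjugate exponent of $p\in[1,\infty]$ ($1/p+1/q=1$), $$D_{p,\Lambda}(\nu,\mu)=\sup_{f\in\mathrm{Loc}(\Omega_\Lambda),\ f\text{ non-constant}}\frac{\int f\,d\nu-\int f\,d\mu}{\|\delta f\|_q}=\sup_{f\in\mathrm{Loc}(\Omega_\Lambda),\ \|\delta f\|_q\le1}\Big(\int f\,d\nu-\int f\,d\mu\Big).$$ For translation-invariant $\mu,\nu$: $D_p(\nu,\mu)=\lim_{n\to\infty}D_{p,\Lambda_n}(\nu,\mu)/|\Lambda_n|^{1/p}$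 for $p\in[1,\infty)$ and $D_\infty(\nu,\mu)=\lim_{n\to\infty}D_{\infty,\Lambda_n}(\nu,\mu)=\sup_nD_{\infty,\Lambda_n}(\nu,\mu)$ (these limits exist). $\bar d(\nu,\mu)=\inf_\Pi\Pi\{\sigma^{(1)}_0\ne\sigma^{(2)}_0\}$, the infimum being over all probability measures $\Pi$ on $\Omega\times\Omega$ (generic point $(\sigma^{(1)},\sigma^{(2)})$) with marginals $\nu$ and $\mu$ that are invariant under the joint shifts $(\sigma^{(1)},\sigma^{(2)})\mapsto(\tau_i\sigma^{(1)},\tau_i\sigma^{(2)})$, $i\in\mathbb{Z}^d$. *)

(* Defs.v *)
From mathcomp Require Import all_boot all_order all_algebra.
From mathcomp Require Import finmap.
From mathcomp Require Import all_classical all_reals all_analysis.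

Set Implicit Arguments.
Unset Strict Implicit.
Unset Printing Implicit Defensive.

Import Order.TTheory GRing.Theory Num.Theory.
Import numFieldNormedType.Exports.

Local Open Scope classical_set_scope.
Local Open Scope ring_scope.
Local Open Scope ereal_scope.

(* [S] is a [pointedType] because measurable types must be inhabited; this
   loses nothing, since there is no probability measure on an empty set. *)
Definition config_space (d : nat) (S : pointedType) :=
  prod_topology (fun _ : 'rV[int]_d => discrete_topology S).

Definition Omega (d : nat) (S : pointedType) :=
  g_sigma_algebraType (@open (config_space d S)).

Definition box {d : nat} (n : nat) : set 'rV[int]_d :=
  [set i | forall k, (`|i ord0 k| <= n)%N].

Section Definitions.
Context {d : nat} {S : pointedType} {R : realType}.
Implicit Types (mu nu : probability (Omega d S) R) (f : Omega d S -> R).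

Definition tau (i : 'rV[int]_d) (eta : Omega d S) : Omega d S :=
  fun j => eta (j - i)%R.

Definition translation_invariant mu : Prop :=
  forall i A, measurable A -> mu (tau i @^-1` A) = mu A.

Definition Loc (L : set 'rV[int]_d) : set (Omega d S -> R) :=
  [set f | forall s t : Omega d S, (forall j, L j -> s j = t j) -> f s = f t].

Definition osc (i : 'rV[int]_d) f : \bar R :=
  ereal_sup [set x | exists s t : Omega d S,
    (forall j, j != i -> s j = t j) /\ x = (f s - f t)%:E].

(* only meant for 1 <= q <= +oo *)
Definition osc_norm (q : \bar R) f : \bar R :=
  match q with
  | r%:E => (\esum_(i in [set: 'rV[int]_d]) osc i f `^ r) `^ r^-1
  | _ => ereal_sup [set osc i f | i in [set: 'rV[int]_d]]
  end.

(* The supremum is taken over the unit ball of [osc_norm] rather than as one of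
   quotients over non-constant [f]: the two agree when [S] has at least two
   points, but for a singleton [S] there is no non-constant [f], and the
   supremum of the empty set in [\bar R] would be [-oo] instead of [0]. *)
Definition DLoc (p : \bar R) (L : set 'rV[int]_d) nu mu : \bar R :=
  ereal_sup [set \int[nu]_s (f s)%:E - \int[mu]_s (f s)%:E |
             f in [set f | Loc L f /\ osc_norm (hoelder_conjugate p) f <= 1]].

(* only meant for 1 <= p <= +oo and translation-invariant measures, for which the
   limits exist *)
Definition D (p : \bar R) nu mu : \bar R :=
  match p with
  | r%:E => limn (fun n => DLoc p (@box d n) nu mu /
                           (#|` fset_set (@box d n)|%:R `^ r^-1)%:E)
  | _ => limn (fun n => DLoc p (@box d n) nu mu)
  end.

Definition invariant_coupling nu mu
    (Pi : probability (Omega d S * Omega d S)%type R) : Prop :=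
  [/\ forall A, measurable A -> Pi (fst @^-1` A) = nu A,
      forall A, measurable A -> Pi (snd @^-1` A) = mu A
    & forall i A, measurable A ->
        Pi ((fun x => (tau i x.1, tau i x.2)) @^-1` A) = Pi A].

Definition dbar nu mu : \bar R :=
  ereal_inf [set Pi [set x | x.1 0%R <> x.2 0%R] |
             Pi in [set Pi | invariant_coupling nu mu Pi]].

End Definitions.

(* Main.v *)
(* For an invariant coupling Pi, telescoping over the sites of the box gives
   nu f - mu f <= Pi(x_0 <> y_0) * sum_i delta_i f, and Hoelder's inequality
   bounds every normalized D_{p,Lambda_n} by Pi(x_0 <> y_0), hence by dbar.
   Conversely, summing the translates f o tau_i, i in Lambda_N, of a function
   with sum_i delta_i f <= 1 yields a function whose oscillations are all at
   most 1, so that D_p >= D_oo up to the factor |Lambda_N| / |Lambda_{N+n}|.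

   It remains to construct an invariant coupling with Pi(x_0 <> y_0) <= D_oo.
   The functions g of a pair of configurations such that some finite sum of
   translates of g - a 1_{x_0 <> y_0}, a >= 0, is dominated by u(x) + v(y) with
   nu u + mu v + a D_oo <= 0 (suitably normalized) form a convex cone. It does
   not contain the constant 1: otherwise the inf-convolution of v with the
   Hamming-type cost a sum_i 1_{x_i <> y_i} would be a local function violating
   the definition of D_oo. A maximal convex cone without 1 (Zorn) determines a
   positive linear functional on bounded functions which is shift invariant,
   since averages of g - g o tau_i along multiples of i telescope. Its values on
   cylinders extend to a probability measure by compactness. *)
From HB Require Import structures.
Require Import Defs.
From mathcomp Require Import all_boot all_order all_algebra.
From mathcomp Require Import finmap.
From mathcomp Require Import all_classical all_reals all_analysis.
From mathcomp Require Import measurable_realfun.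
From mathcomp Require Import ring lra zify.

Set Implicit Arguments.
Unset Strict Implicit.
Unset Printing Implicit Defensive.

Import Order.TTheory GRing.Theory Num.Theory.
Import numFieldNormedType.Exports.

Local Open Scope classical_set_scope.
Local Open Scope ring_scope.

(** * Cylinder sets *)

Section Cylinders.
Context {d : nat} {S : pointedType}.
Implicit Types A B : set (Omega d S).

Definition agree (n : nat) (s t : Omega d S) := forall j, box n j -> s j = t j.

(** Boxes are cofinal among the finite sets of sites, so these are the sets determined by finitely
    many coordinates. *)
Definition cylinder : set (set (Omega d S)) :=
  [set A | exists n, forall s t, agree n s t -> A s -> A t].

Lemma box_le (m n : nat) : (m <= n)%N -> @box d m `<=` box n.
Proof. by move=> mn i im k; exact: leq_trans (im k) mn. Qed.

Lemma agree_le (m n : nat) s t : (m <= n)%N -> agree n s t -> agree m s t.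
Proof. by move=> mn st j /(box_le mn); exact: st. Qed.

Lemma agreeC n s t : agree n s t -> agree n t s.
Proof. by move=> st j /st. Qed.

Lemma cylinder0 : cylinder set0.
Proof. by exists 0%N. Qed.

Lemma cylinderC : setC_closed cylinder.
Proof.
move=> A [n An]; exists n => s t st nAs At; apply: nAs.
by apply: An At; exact: agreeC.
Qed.

Lemma cylinderU : setU_closed cylinder.
Proof.
move=> A B [m Am] [n Bn]; exists (maxn m n) => s t st [As|Bs].
  by left; apply: Am As; apply: agree_le st; rewrite leq_maxl.
by right; apply: Bn Bs; apply: agree_le st; rewrite leq_maxr.
Qed.

Lemma cylinderI : setI_closed cylinder.
Proof.
move=> A B cA cB; rewrite -[A `&` B]setCK setCI.
by apply: cylinderC; apply: cylinderU; exact: cylinderC.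
Qed.

Lemma cylinderT : cylinder setT.
Proof. by rewrite -setC0; exact/cylinderC/cylinder0. Qed.

Lemma mem_box (i : 'rV[int]_d) : exists n, box n i.
Proof.
exists (\max_(k < d) `|i ord0 k|%N)%N => k.
exact: (leq_bigmax k).
Qed.

(** An explicit parametrization of the box; it yields both its finiteness and its cardinality. *)
Definition box_point n (v : {ffun 'I_d -> 'I_(2 * n).+1}) : 'rV[int]_d :=
  \row_k ((v k)%:Z - n%:Z).

Lemma box_point_inj n : injective (@box_point n).
Proof.
move=> v w /rowP vw; apply/ffunP => k; apply/val_inj => /=.
by have := vw k; rewrite !mxE => /addIr[].
Qed.

Lemma range_box_point n : range (@box_point n) = box n.
Proof.
apply/seteqP; split => [_ [v _ <-] k|i ni].
  by rewrite mxE; have := ltn_ord (v k); lia.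
have hk (k : 'I_d) : (`|(i ord0 k + n%:Z)%R|%N < (2 * n).+1)%N.
  by have : (`|i ord0 k| <= n)%N := ni k; lia.
exists [ffun k => Ordinal (hk k)] => //; apply/rowP => k.
rewrite mxE ffunE /= -[RHS]/(i ord0 k).
by have : (`|i ord0 k| <= n)%N := ni k; lia.
Qed.

Lemma finite_box n : finite_set (@box d n).
Proof. by rewrite -range_box_point; exact/finite_image/finite_finset. Qed.

Lemma agree_nbhs (s : config_space d S) n :
  nbhs s [set t | agree n s t].
Proof.
have FF : Filter (nbhs s) by exact: nbhs_filter.
rewrite (_ : [set t | _] = \bigcap_(j in box n) [set t | s j = t j]);
  last first.
  by apply/seteqP; split => t.
rewrite -[box n](fset_setK (finite_box n)).
rewrite bigcap_fset; apply: (big_ind (fun A => nbhs s A)) => [|P Q|j _].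
- exact: (@filterT _ _ FF).
- exact: (@filterI _ _ FF).
have /(_ [set t | s j = t]) :=
  @proj_continuous _ (fun _ : 'rV[int]_d => discrete_topology S) j s.
apply; have /= := @discrete_set1 (discrete_topology S) (s j).
by rewrite nbhs_principalE => ss t /ss.
Qed.

Lemma cylinder_open A : cylinder A -> @open (config_space d S) A.
Proof.
move=> [n An]; rewrite openE => s As.
by apply: filterS (agree_nbhs s n) => t st; exact: An As.
Qed.

(** The filter generated by the agreement sets converges to [s] in each coordinate, hence in the
    product topology, so it contains every neighbourhood of [s]. *)
Lemma nbhs_agree (s : config_space d S) (U : set (config_space d S)) :
  nbhs s U -> exists n, agree n s `<=` U.
Proof.
pose F := filter_from [set: nat] (fun n => agree n s : set (config_space d S)).
have FF : Filter F.
  apply: filter_from_filter; first by exists 0%N.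
  move=> m n _ _; exists (maxn m n) => // t st; split;
    by apply: agree_le st; rewrite ?leq_maxl ?leq_maxr.
have : F --> s.
  apply/cvg_sup => j V [W] [[C oC <-]] Cs CV.
  have [n nj] := mem_box j; exists n => // t st.
  by apply: CV => /=; rewrite -(st _ nj).
by move=> /[apply] -[n _]; exists n.
Qed.

(** [F n] consists of the points whose whole class under agreement on [box n] lies in [U]. *)
Lemma open_bigcup_cylinder U : @open (config_space d S) U ->
  exists2 F : (set (Omega d S))^nat, forall n, cylinder (F n) &
    U = \bigcup_n F n.
Proof.
rewrite openE => oU; exists (fun n => [set s | agree n s `<=` U]).
  move=> n; exists n => s t st /= sU r tr; apply: sU => j nj.
  by rewrite st// tr.
apply/seteqP; split => s.
  by move=> /oU /nbhs_agree[n nU]; exists n.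
by move=> [n _]; apply.
Qed.

Lemma g_sigma_cylinder : <<s cylinder >> = @measurable _ (Omega d S).
Proof.
apply/seteqP; split.
  apply: smallest_sub; first exact: sigma_algebra_measurable.
  by move=> A /cylinder_open oA; apply: sub_sigma_algebra.
apply: smallest_sub; first exact: smallest_sigma_algebra.
move=> U /open_bigcup_cylinder[F cF ->].
by apply: sigma_algebra_bigcup => n; apply: sub_sigma_algebra.
Qed.

Lemma measurable_cylinder A : cylinder A -> measurable A.
Proof. by move=> /cylinder_open oA; apply: sub_sigma_algebra. Qed.

(** Cylinders are clopen and, for finite [S], the configuration space is compact by Tychonoff. This
    turns finite additivity on cylinders into countable subadditivity. *)
Lemma cylinder_cover A (F : (set (Omega d S))^nat) : finite_set [set: S] ->
  cylinder A -> (forall n, cylinder (F n)) -> A `<=` \bigcup_n F n ->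
  exists N, A `<=` \big[setU/set0]_(n < N) F n.
Proof.
move=> finS cA cF AF.
have cT : compact [set: config_space d S].
  have := @tychonoff _ (fun _ : 'rV[int]_d => discrete_topology S)
    (fun=> setT) (fun=> @finite_compact (discrete_topology S) setT finS).
  by congr compact; apply/seteqP; split.
have cloA : @closed (config_space d S) A.
  by rewrite -openC; apply: cylinder_open; exact: cylinderC.
have /compact_near_coveringP := subclosed_compact cloA cT (@subsetT _ A).
pose P N (s : config_space d S) := (\bigcup_(n < N) F n) s.
move=> /(_ nat \oo P _)[].
  move=> s /AF[n _ Fns]; exists (F n, [set N | (n < N)%N]) => /=.
    split; last exact: nbhs_infty_gt.
    by apply: open_nbhs_nbhs; split => //; exact: cylinder_open.
  by case=> t N [/= Fnt nN]; exists n.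
move=> N _ /(_ N (leqnn N)) AN; exists N.
by rewrite -bigcup_mkord.
Qed.

End Cylinders.

(** * Extension of finitely additive contents on cylinders *)

(** An alias that carries the algebra of cylinders as its measurable structure, kept apart from the
    Borel structure of [Omega]. *)
Definition cylinder_space (d : nat) (S : pointedType) := Omega d S.

HB.instance Definition _ d S := Pointed.on (cylinder_space d S).
HB.instance Definition _ d S :=
  isAlgebraOfSets.Build default_measure_display (cylinder_space d S)
    cylinder0 cylinderU cylinderC.

Section CylinderExtension.
Context {d : nat} {S : pointedType} {R : realType}.
Variable m : set (Omega d S) -> R.
Hypothesis finS : finite_set [set: S].
Hypothesis m_ge0 : forall A, 0 <= m A.
Hypothesis mT : m setT = 1.
Hypothesis mU : forall A B, A `&` B = set0 -> m (A `|` B) = m A + m B.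

Definition cylinder_content (A : set (cylinder_space d S)) : \bar R := (m A)%:E.

Let m0 : m set0 = 0.
Proof.
by apply: (addrI (m set0)); rewrite -mU ?setU0 ?addr0// setI0.
Qed.

Let content_ge0 A : (0 <= cylinder_content A)%E.
Proof. by rewrite lee_fin. Qed.

Let content_additive : measure_function.semi_additive cylinder_content.
Proof.
move=> F n _ tF _; rewrite /cylinder_content sumEFin; congr EFin.
elim: n => [|n IH]; first by rewrite !big_ord0.
rewrite !big_ord_recr/= mU ?IH//.
rewrite -bigcup_mkord setI_bigcupl.
apply: bigcup0 => i /= ni.
move/trivIsetP : tF => /(_ i n I I); rewrite neq_ltn ni.
exact.
Qed.

HB.instance Definition _ := isContent.Build _ _ _ cylinder_content
  content_ge0 content_additive.

Let content_sigma_subadditive :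
  measurable_subset_sigma_subadditive cylinder_content.
Proof.
move=> A F cF cA AF.
have [N AN] := cylinder_cover finS cA cF AF.
apply: (@le_trans _ _ (\sum_(n < N) cylinder_content (F n))%E).
  by apply: content_subadditive => // k _; exact: cF.
rewrite -(big_mkord xpredT (fun i => cylinder_content (F i))).
exact: nneseries_lim_ge.
Qed.

HB.instance Definition _ := Content_SigmaSubAdditive_isMeasure.Build _ _ _
  cylinder_content content_sigma_subadditive.

Lemma cylinder_extension : exists P : probability (Omega d S) R,
  forall A, cylinder A -> P A = (m A)%:E.
Proof.
(* The Caratheodory extension lives on the sigma-algebra generated by the cylinders. This is the
   Borel one, so the identity is measurable and pushes the extension forward to [Omega d S]. *)
pose I := g_sigma_algebraType (@measurable _ (cylinder_space d S)).
have mid : measurable_fun [set: I] (id : I -> Omega d S).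
  move=> _ A mA; rewrite setTI /preimage /=.
  by move: mA; rewrite -g_sigma_cylinder.
pose f : {mfun I >-> Omega d S} := HB.pack id (isMeasurableFun.Build _ _ _ _ _
  mid).
pose Q0 : {measure set I -> \bar R} := measure_extension cylinder_content.
have Q0E A : cylinder A -> Q0 A = (m A)%:E.
  by move=> cA; rewrite /Q0/= /measure_extension measurable_mu_extE.
have Q0T : Q0 setT = 1%E by rewrite Q0E ?mT//; exact: cylinderT.
pose Q : probability I R :=
  HB.pack (Measure.sort Q0) (Measure_isProbability.Build _ _ _ Q0 Q0T).
by exists (distribution Q f) => A; exact: Q0E.
Qed.

End CylinderExtension.

(** * Functionals from maximal cones *)

Section ConeFunctional.
Context {R : realType} {V : lmodType R}.
Implicit Types (C : set V) (g h : V).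

Definition convex_cone C := [/\ C 0, forall g h, C g -> C h -> C (g + h) &
  forall t g, 0 <= t -> C g -> C (t *: g)].

Lemma maximal_cone (e : V) C : convex_cone C -> ~ C e ->
  exists K, [/\ convex_cone K, C `<=` K, ~ K e &
    forall g, K g \/ exists2 t, 0 < t & K (e - t *: g)].
Proof.
move=> cC nCe.
(* Zorn is applied to the sets [X] added to [C], so that the union of the empty chain satisfies [P]
   too. *)
pose P X := convex_cone (C `|` X) /\ ~ (C `|` X) e.
have [F FP Ftot|A [[cA nAe] Amax]] := @Zorn_bigcup V P.
  have [->|/set0P[X0 FX0]] := eqVneq F set0.
    by rewrite bigcup_set0 /P setU0.
  have C_F g : (C `|` \bigcup_(X in F) X) g -> exists2 X, F X & (C `|` X) g.
    case=> [Cg|[X FX Xg]]; first by exists X0 => //; left.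
    by exists X => //; right.
  have F_C X g : F X -> (C `|` X) g -> (C `|` \bigcup_(X in F) X) g.
    by move=> FX [Cg|Xg]; [left|right; exists X].
  split; last by move=> /C_F[X /FP[]].
  split.
  - by left; case: cC.
  - move=> g h /C_F[X FX Xg] /C_F[Y FY Yh].
    have [XY|YX] := Ftot X Y FX FY.
      apply: (F_C Y) => //; have [[_ + _] _] := FP Y FY; apply => //.
      exact: setUS XY _ Xg.
    apply: (F_C X) => //; have [[_ + _] _] := FP X FX; apply => //.
    exact: setUS YX _ Yh.
  - move=> t g t0 /C_F[X FX Xg]; apply: (F_C X) => //.
    by have [[_ _ +] _] := FP X FX; apply.
exists (C `|` A); split => // g.
have [|nKg] := pselect ((C `|` A) g); first by left.
right; apply: contrapT => nK; have [K0 KD KZ] := cA.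
(* The cone spanned by [C], [A] and [g]. It is strictly larger than [A], so it contradicts
   maximality unless it contains [e]; and a representation [e = k + t *: g] must have [t > 0]. *)
pose B := [set x | exists t k, [/\ 0 <= t, (C `|` A) k & x = k + t *: g]].
have KB x : (C `|` A) x -> B x.
  by move=> Kx; exists 0, x; rewrite scale0r addr0.
have CB : C `|` B = B.
  by apply/seteqP; split => x; [case=> // Cx; apply: KB; left|right].
apply: (Amax B).
  split; first by move=> x Ax; apply: KB; right.
  move=> BA; apply: nKg; right; apply: BA.
  by exists 1, 0; rewrite ler01 scale1r add0r.
rewrite /P CB; split.
  split; first exact: KB.
    move=> _ _ [t [k [t0 Kk ->]]] [u [l [u0 Kl ->]]].
    exists (t + u), (k + l); split; [exact: addr_ge0|exact: KD|].
    by rewrite scalerDl addrACA.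
  move=> u _ u0 [t [k [t0 Kk ->]]].
  exists (u * t), (u *: k); split; [exact: mulr_ge0|exact: KZ|].
  by rewrite scalerDr scalerA.
move=> [t [k [t0 Kk ekt]]]; move: t0; rewrite le_eqVlt => /predU1P[t0|t0].
  by apply: nAe; rewrite ekt -t0 scale0r addr0.
by apply: nK; exists t => //; rewrite ekt addrK.
Qed.

(** In the preorder whose nonpositive elements form [C], both [g] and [- g] lie below a multiple of
    [e]. *)
Definition order_bounded C e :=
  [set g | exists2 c, C (g - c *: e) & C (- g - c *: e)].

(** [L g] is the infimum of the [c] for which [g - c *: e] lies in a maximal cone [K]. Since [K] and
    its negative cover the space, the upper value of [g] is also its lower value, which makes [L]
    additive. *)
Lemma cone_functional C (e : V) : convex_cone C -> C (- e) -> ~ C e ->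
  exists L : V -> R,
    (forall g h, order_bounded C e g -> order_bounded C e h ->
      L (g + h) = L g + L h) /\
    (forall g c, order_bounded C e g -> C (g - c *: e) -> L g <= c).
Proof.
move=> cC CNe nCe; have [K [[K0 KD KZ] CK nKe Kmax]] := maximal_cone cC nCe.
have KNe t : 0 <= t -> K (- (t *: e)).
  by move=> t0; rewrite -scalerN; apply: KZ => //; exact: CK.
have nKpos t : 0 < t -> ~ K (t *: e).
  move=> t0 Kte; apply: nKe; rewrite -[e](scalerK (lt0r_neq0 t0)).
  by apply: KZ => //; rewrite invr_ge0 ltW.
(* If [g] is not in [K], maximality puts [e - t *: g] in [K] for some [t > 0]; adding [- e] leaves
   [- (t *: g)]. *)
have KN g : ~ K g -> K (- g).
  have [//|[t t0 Ket]] := Kmax g => _.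
  rewrite -[- g](scalerK (lt0r_neq0 t0)); apply: KZ;
    first by rewrite invr_ge0 ltW.
  rewrite (_ : t *: - g = (e - t *: g) - e); last first.
    by rewrite addrAC subrr add0r scalerN.
  by apply: KD => //; exact: CK.
pose U g := [set c | K (g - c *: e)].
pose L g := inf (U g).
have supU g : order_bounded C e g -> has_inf (U g).
  move=> [c gc Ngc]; split; first by exists c; exact: CK.
  exists (- c) => x Ux; rewrite lerNl leNgt; apply/negP => cx.
  have /KD/(_ (CK _ Ngc)) := Ux.
  rewrite addrACA subrr add0r -opprD -scalerDl -scaleNr; apply: nKpos.
  by rewrite oppr_gt0; move: cx; lra.
have LU g c : order_bounded C e g -> L g < c -> K (g - c *: e).
  move=> /supU[U0 _] /(inf_lt U0)[x Ux xc].
  rewrite -[g](subrK (x *: e)) -addrA -scalerBl; apply: KD => //.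
  by rewrite -opprB scaleNr; apply: KNe; rewrite subr_ge0 ltW.
have UL g c : order_bounded C e g -> K (g - c *: e) -> L g <= c.
  by move=> /supU[_ lbU] Kgc; exact: ge_inf.
have LN g c : order_bounded C e g -> c < L g -> K (- g + c *: e).
  move=> bg cL; rewrite -[c *: e]opprK -opprD; apply: KN => Kgc.
  by move: cL; rewrite ltNge UL.
exists L; split; last by move=> g c bg /CK; exact: UL.
move=> g h bg bh.
have bgh : order_bounded C e (g + h).
  case: cC => _ CD _; case: bg bh => [a ga Nga] [b hb Nhb].
  exists (a + b).
    by rewrite scalerDl opprD addrACA; exact: CD.
  by rewrite scalerDl !opprD addrACA; exact: CD.
apply/eqP; rewrite eq_le; apply/andP; split.
  apply/ler_addgt0Pr => eps eps0; apply: UL => //.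
  have := KD _ _ (LU g (L g + eps / 2) bg _) (LU h (L h + eps / 2) bh _).
  rewrite addrACA -opprD -scalerDl addrACA -splitr.
  by apply; rewrite ltrDl divr_gt0.
(* A gap of [3 * eps] in superadditivity leaves room for errors [eps], [eps] and [eps / 2] in three
   elements of [K], whose sum is then the forbidden [(eps / 2) *: e]. *)
rewrite leNgt; apply/negP => Lgh.
pose eps := (L g + L h - L (g + h)) / 3.
have eps0 : 0 < eps by rewrite divr_gt0// subr_gt0.
have K1 : K (g + h - (L (g + h) + eps) *: e) by apply: LU => //; rewrite ltrDl.
have K2 : K (- g + (L g - eps) *: e) by apply: LN => //; rewrite ltrBlDr ltrDl.
have K3 : K (- h + (L h - eps / 2) *: e).
  by apply: LN => //; rewrite ltrBlDr ltrDl divr_gt0.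
have := KD _ _ K1 (KD _ _ K2 K3).
rewrite [(- g + _) + _]addrACA -opprD -scalerDl addrACA subrr add0r.
rewrite -scaleNr -scalerDl; apply: nKpos.
rewrite (_ : _ + _ = eps / 2); first by rewrite divr_gt0.
by rewrite /eps; field.
Qed.

End ConeFunctional.

(** * Oscillations *)

Section Oscillation.
Context {d : nat} {S : pointedType} {R : realType}.
Implicit Types (f : Omega d S -> R) (a : 'rV[int]_d -> R).

Definition box_sites n : seq 'rV[int]_d := fset_set (@box d n).

Lemma mem_box_sites n i : (i \in box_sites n) = (i \in box n).
Proof. exact: (in_fset_set (finite_box n)). Qed.

Lemma osc_ge i f s t : (forall j, j != i -> s j = t j) ->
  ((f s - f t)%:E <= osc i f)%E.
Proof. by move=> st; apply: ereal_sup_ubound; exists s, t. Qed.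

Lemma osc_ge0 i f : (0 <= osc i f)%E.
Proof.
by have := @osc_ge i f point point (fun _ _ => erefl); rewrite subrr.
Qed.

Lemma osc_le i f (x : R) :
  (forall s t, (forall j, j != i -> s j = t j) -> f s - f t <= x) ->
  (osc i f <= x%:E)%E.
Proof.
by move=> fx; apply: ge_ereal_sup => _ [s [t [st ->]]]; rewrite lee_fin fx.
Qed.

Lemma osc_outside L i f : Loc L f -> ~ L i -> osc i f = 0%E.
Proof.
move=> fL nLi; apply/eqP; rewrite eq_le osc_ge0 andbT.
apply: osc_le => s t st; rewrite (fL s t) ?subrr// => j Lj.
by apply: st; apply: contra_notN nLi => /eqP <-.
Qed.

(** Turn [t] into [s] one site of [r] at a time; a site where they already agree costs nothing. *)
Lemma osc_telescope a f (r : seq 'rV[int]_d) s t :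
  (forall i, osc i f <= (a i)%:E)%E -> (forall j, j \notin r -> s j = t j) ->
  f s - f t <= \sum_(i <- r) a i * (s i != t i)%:R.
Proof.
move=> fa; have a0 i : 0 <= a i by rewrite -lee_fin (le_trans (osc_ge0 i f)).
elim: r s t => [|i r IH] s t st.
  rewrite big_nil (_ : s = t) ?subrr//.
  by apply/funext => j; exact: st.
pose u : Omega d S := fun j => if j == i then s i else t j.
have su : f s - f u <= \sum_(k <- r) a k * (s k != t k)%:R.
  apply: (le_trans (IH s u _)).
    move=> j jr; rewrite /u; have [->//|ji] := eqVneq j i.
    by apply: st; rewrite inE negb_or ji.
  apply: ler_sum => k _; rewrite ler_wpM2l// /u.
  by have [->|//] := eqVneq k i; rewrite eqxx.
have ut : f u - f t <= a i * (s i != t i)%:R.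
  have [sti|_] := eqVneq (s i) (t i).
    rewrite mulr0 (_ : u = t) ?subrr//; apply/funext => j.
    by rewrite /u; have [->|] := eqVneq j i.
  rewrite mulr1 -lee_fin (le_trans _ (fa i))//; apply: osc_ge => j.
  by rewrite /u => /negbTE ->.
by rewrite big_cons -(subrKA (f u)) addrC lerD.
Qed.

(** [f] ignores the sites outside the box, so [t] may be replaced there by [s], after which only box
    sites differ. *)
Lemma Loc_box_telescope n a f s t : Loc (box n) f ->
  (forall i, osc i f <= (a i)%:E)%E ->
  f s - f t <= \sum_(i <- box_sites n) a i * (s i != t i)%:R.
Proof.
move=> fn fa; pose u : Omega d S := fun j => if j \in box_sites n then t j else
  s j.
have -> : f t = f u.
  by apply: fn => j nj; rewrite /u mem_box_sites mem_set.
apply: (le_trans (osc_telescope fa (r := box_sites n) _)).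
  by move=> j; rewrite /u => /negbTE ->.
by rewrite !big_seq; apply: ler_sum => i; rewrite /u => ->.
Qed.

Lemma hoelder_conjugate_fin (r : R) : 1 < r ->
  hoelder_conjugate r%:E = (r / (r - 1))%:E.
Proof.
move=> r1; rewrite /hoelder_conjugate/= eqe (gt_eqF (lt_trans ltr01 r1)).
by rewrite -EFinD inver subr_eq0 (gt_eqF r1) -EFinM.
Qed.

Lemma osc_norm_fin (q : R) f : 1 <= q -> (osc_norm q%:E f <= 1)%E ->
  (\esum_(i in [set: 'rV[int]_d]) osc i f `^ q <= 1)%E.
Proof.
move=> q1; have q0 : 0 < q by rewrite (lt_le_trans _ q1).
rewrite /osc_norm => Eq; set E := esum _ _ in Eq *.
have E0 : (0 <= E)%E by apply: esum_ge0 => i _; exact: poweR_ge0.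
rewrite -(poweRe1 E0) -[in leLHS](mulVf (lt0r_neq0 q0)) poweRrM
  -[leRHS](poweR1r q).
apply: gt0_ler_poweR => //; first exact: ltW.
  by rewrite in_itv/= leey poweR_ge0.
by rewrite in_itv/= leey lee01.
Qed.

(** Hoelder's inequality against the constant 1 on the box: the unit ball of the conjugate norm is
    used later only through this bound on the sum of oscillations. *)
Lemma osc_norm_box n (p : \bar R) f : (1 <= p)%E -> Loc (box n) f ->
  (osc_norm (hoelder_conjugate p) f <= 1)%E ->
  exists2 a, forall i, osc i f = (a i)%:E &
  \sum_(i <- box_sites n) a i <=
    if p is r%:E then (size (box_sites n))%:R `^ r^-1 else 1.
Proof.
move=> p1 fn fp.
(* The case of a finite conjugate exponent [q]: the norm bound forces each oscillation to be finite,
   so real weights exist. *)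
have main (q : R) : 1 <= q -> hoelder_conjugate p = q%:E ->
  exists2 a, forall i, osc i f = (a i)%:E &
    \sum_(i <- box_sites n) (a i) `^ q <= 1.
  move=> q1 pq; have q0 : 0 < q by rewrite (lt_le_trans _ q1).
  have Eq := osc_norm_fin q1; rewrite -pq in Eq; have {}Eq := Eq _ fp.
  have oscq i : (osc i f `^ q <= 1)%E.
    apply: le_trans Eq; apply: esum_ge; exists [set i];
      last by rewrite fsbig_set1.
    by split => //; exact: finite_set1.
  have osc1 i : osc i f \is a fin_num.
    rewrite ge0_fin_numE ?osc_ge0//; apply: (lty_poweRy (lt0r_neq0 q0)).
    by rewrite (le_lt_trans (oscq i))// ltry.
  exists (fun i => fine (osc i f)) => [i|]; first by rewrite fineK.
  rewrite -lee_fin (le_trans _ Eq)//; apply: esum_ge; exists (box n).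
    by split => //; exact: finite_box.
  rewrite fsbig_finite//=; last exact: finite_box.
  rewrite -sumEFin; apply: lee_sum => i _.
  by rewrite -poweR_EFin fineK.
case: p p1 fp main => [r|_|//]; last first.
  rewrite hoelder_conjugatey => _ /(_ 1 (lexx _) erefl)[a fa a1].
  exists a => //; rewrite (le_trans _ a1)//; apply: ler_sum => i _.
  by rewrite powRr1// -lee_fin -fa osc_ge0.
rewrite lee_fin => r1; have r0 : 0 < r by rewrite (lt_le_trans _ r1).
move: r1; rewrite le_eqVlt => /predU1P[<-|r1].
  rewrite hoelder_conjugate1/= => f1 _.
  have osc1 i : (osc i f <= 1)%E.
    by apply: le_trans f1; apply: ereal_sup_ubound; exists i.
  have oscf i : osc i f \is a fin_num.
    by rewrite ge0_fin_numE ?osc_ge0// (le_lt_trans (osc1 i))// ltry.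
  exists (fun i => fine (osc i f)) => [i|]; first by rewrite fineK.
  rewrite invr1 powRr1// -sum1_size natr_sum; apply: ler_sum => i _.
  by rewrite -lee_fin fineK.
have r1' : 0 < r - 1 by rewrite subr_gt0.
move=> fr /(_ (r / (r - 1))) main.
have pq := hoelder_conjugate_fin r1.
have q1 : 1 <= r / (r - 1) by rewrite ler_pdivlMr// mul1r; lra.
have {main}[a fa a1] := main q1 pq.
have a0 i : 0 <= a i by rewrite -lee_fin -fa osc_ge0.
exists a => //; set N : R := (size _)%:R.
have [N0|] := eqVneq (size (box_sites n)) 0%N.
  by rewrite (size0nil N0) big_nil powR_ge0.
rewrite -lt0n => N0; have {}N0 : 0 < N by rewrite ltr0n.
pose c := N `^ (- r^-1).
have c0 : 0 < c by rewrite powR_gt0.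
have Nc : N `^ r^-1 = c^-1 by rewrite /c powRN invrK.
rewrite Nc -[leRHS]mul1r ler_pdivlMr// mulr_suml.
have Ncr : N * c `^ r = 1.
  rewrite /c -powRrM mulNr mulVf ?gt_eqF// powRN powRr1 ?ltW//.
  by rewrite divff// gt_eqF.
have Y i : a i * c <= a i `^ (r / (r - 1)) / (r / (r - 1)) + c `^ r / r.
  apply: conjugate_powR; rewrite ?(ltW c0)// ?divr_gt0//.
  by field; rewrite !gt_eqF.
apply: (le_trans (ler_sum _ (fun i _ => Y i))).
rewrite big_split/= -mulr_suml big_const_seq count_predT iter_addr_0 -mulr_natr.
rewrite -/N mulrAC [c `^ r * N]mulrC Ncr.
have : (\sum_(i <- box_sites n) a i `^ (r / (r - 1))) / (r / (r - 1)) <=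
    1 / (r / (r - 1)).
  by rewrite ler_pM2r// invr_gt0 divr_gt0.
rewrite -(lerD2r (1 / r)) => /le_trans; apply.
by rewrite le_eqVlt; apply/orP; left; apply/eqP; field; rewrite !gt_eqF.
Qed.

End Oscillation.

(** * Bounded measurable functions *)

Section BoundedMeasurable.
Context {dT : measure_display} {T : measurableType dT} {R : realType}.
Implicit Types (P : probability T R) (f g : T -> R).

Definition bounded_measurable : set (T -> R) :=
  [set f : T -> R | measurable_fun setT f /\ exists M, forall x, `|f x| <= M].

Lemma bounded_measurable_cst (r : R) : bounded_measurable (fun=> r).
Proof. by split; [exact: measurable_cst|exists `|r|]. Qed.

Lemma bounded_measurableD f g : bounded_measurable f -> bounded_measurable g ->
  bounded_measurable (fun x => f x + g x).
Proof.
move=> [mf [M fM]] [mg [N gN]]; split; first exact: measurable_funD.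
by exists (M + N) => x; rewrite (le_trans (ler_normD _ _))// lerD.
Qed.

Lemma bounded_measurableZ (r : R) f : bounded_measurable f ->
  bounded_measurable (fun x => r * f x).
Proof.
move=> [mf [M fM]]; split.
  by apply: measurable_funM => //; exact: measurable_cst.
by exists (`|r| * M) => x; rewrite normrM ler_wpM2l.
Qed.

Lemma bounded_measurableB f g : bounded_measurable f -> bounded_measurable g ->
  bounded_measurable (fun x => f x - g x).
Proof.
move=> bf bg; have := bounded_measurableD bf (bounded_measurableZ (-1) bg).
by under eq_fun do rewrite mulN1r.
Qed.

Lemma bounded_measurable_sum I (r : seq I) (F : I -> T -> R) :
  (forall i, bounded_measurable (F i)) ->
  bounded_measurable (fun x => \sum_(i <- r) F i x).
Proof.
move=> bF; elim: r => [|i r IH].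
  by under eq_fun do rewrite big_nil; exact: bounded_measurable_cst.
by under eq_fun do rewrite big_cons; exact: bounded_measurableD.
Qed.

Lemma bounded_measurable_integrable P f : bounded_measurable f ->
  P.-integrable setT (EFin \o f).
Proof.
move=> [mf [M fM]]; apply: measurable_bounded_integrable => //.
  exact: (le_lt_trans (probability_le1 P measurableT) (ltry _)).
exists M; split; first exact: num_real.
by move=> x Mx t _ /=; rewrite (le_trans (fM t))// ltW.
Qed.

Lemma integral_EFin P f : bounded_measurable f ->
  (\int[P]_x (f x)%:E)%E = (\int[P]_x f x)%:E.
Proof.
move=> bf; rewrite /Rintegral fineK//; apply: integrable_fin_num => //.
exact: bounded_measurable_integrable.
Qed.

Lemma prob_Rintegral_cst P (r : R) : \int[P]_x r = r.
Proof. by rewrite Rintegral_cst//= probability_setT mulr1. Qed.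

Lemma prob_RintegralD P f g : bounded_measurable f -> bounded_measurable g ->
  \int[P]_x (f x + g x) = \int[P]_x f x + \int[P]_x g x.
Proof.
by move=> bf bg; apply: RintegralD => //; exact: bounded_measurable_integrable.
Qed.

Lemma prob_RintegralZ P (r : R) f : bounded_measurable f ->
  \int[P]_x (r * f x) = r * \int[P]_x f x.
Proof.
by move=> bf; apply: RintegralZl => //; exact: bounded_measurable_integrable.
Qed.

Lemma prob_RintegralB P f g : bounded_measurable f -> bounded_measurable g ->
  \int[P]_x (f x - g x) = \int[P]_x f x - \int[P]_x g x.
Proof.
by move=> bf bg; apply: RintegralB => //; exact: bounded_measurable_integrable.
Qed.

Lemma prob_Rintegral_sum P I (r : seq I) (F : I -> T -> R) :
  (forall i, bounded_measurable (F i)) ->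
  \int[P]_x (\sum_(i <- r) F i x) = \sum_(i <- r) \int[P]_x F i x.
Proof.
move=> bF; elim: r => [|i r IH].
  rewrite big_nil -[RHS](prob_Rintegral_cst P); apply: eq_Rintegral => x _.
  by rewrite big_nil.
rewrite big_cons -IH -prob_RintegralD//; last exact: bounded_measurable_sum.
by apply: eq_Rintegral => x _; rewrite big_cons.
Qed.

Lemma le_prob_Rintegral P f g : bounded_measurable f -> bounded_measurable g ->
  (forall x, f x <= g x) -> \int[P]_x f x <= \int[P]_x g x.
Proof.
move=> bf bg fg; apply: le_Rintegral => //;
  exact: bounded_measurable_integrable.
Qed.

Lemma bounded_measurable_indic (A : set T) : measurable A ->
  bounded_measurable (\1_A : T -> R).
Proof.
move=> mA; split; first exact: measurable_indic.
by exists 1 => x; rewrite indicE; case: (_ \in _); rewrite ?normr1 ?normr0.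
Qed.

Lemma prob_Rintegral_indic P (A : set T) : measurable A ->
  (\int[P]_x (\1_A x : R))%:E = P A.
Proof.
move=> mA; rewrite -integral_EFin; last exact: bounded_measurable_indic.
by rewrite integral_indic// setIT.
Qed.

Lemma prob_Rintegral_indicC P (A : set T) : measurable A ->
  \int[P]_x (\1_(~` A) x : R) = 1 - \int[P]_x (\1_A x : R).
Proof.
move=> mA; apply: EFin_inj; rewrite prob_Rintegral_indic;
  last exact: measurableC.
by rewrite probability_setC// EFinB prob_Rintegral_indic.
Qed.

End BoundedMeasurable.

Lemma bounded_measurable_comp d1 d2 (T1 : measurableType d1)
    (T2 : measurableType d2) (R : realType) (h : T1 -> T2) (f : T2 -> R) :
  measurable_fun setT h -> bounded_measurable f ->
  bounded_measurable (fun x => f (h x)).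
Proof.
move=> mh [mf [M fM]]; split; last by exists M.
exact: (measurableT_comp mf mh).
Qed.

Lemma prob_Rintegral_comp d1 d2 (T1 : measurableType d1) (T2 : measurableType
  d2)
    (R : realType) (P : probability T1 R) (Q : probability T2 R) (h : T1 -> T2)
    (f : T2 -> R) :
  measurable_fun setT h -> (forall A, measurable A -> P (h @^-1` A) = Q A) ->
  bounded_measurable f -> \int[P]_x f (h x) = \int[Q]_y f y.
Proof.
move=> mh PQ bf; rewrite /Rintegral; congr fine.
pose hm : {mfun T1 >-> T2} := HB.pack h (isMeasurableFun.Build _ _ _ _ _ mh).
rewrite (@eq_measure_integral _ _ _ _ (distribution P hm : {measure set T2 ->
  \bar R}))//.
  rewrite integral_distribution//; first by case: bf => mf _;
    exact/measurable_EFinP.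
  exact: (bounded_measurable_integrable P (bounded_measurable_comp mh bf)).
by move=> A mA _; exact: esym (PQ A mA).
Qed.

(** * Shifts and the coupling upper bound *)

Section Shifts.
Context {d : nat} {S : pointedType}.

Lemma box_sub m n (i j : 'rV[int]_d) :
  box m i -> box n j -> box (m + n) (i - j).
Proof.
move=> mi nj k; rewrite !mxE; have := mi k; have := nj k; rewrite /=; lia.
Qed.

Lemma tauD (i j : 'rV[int]_d) (s : Omega d S) : tau i (tau j s) = tau (i + j) s.
Proof. by apply/funext => k; rewrite /tau opprD addrA. Qed.

Lemma tau0 (s : Omega d S) : tau 0 s = s.
Proof. by apply/funext => k; rewrite /tau subr0. Qed.

Lemma agree_tau m n (i : 'rV[int]_d) (s t : Omega d S) : box m i ->
  agree (n + m) s t -> agree n (tau i s) (tau i t).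
Proof. by move=> mi st j nj; apply: st; exact: box_sub. Qed.

Lemma cylinder_tau (i : 'rV[int]_d) (A : set (Omega d S)) :
  cylinder A -> cylinder (tau i @^-1` A).
Proof.
move=> [n An]; have [m mi] := mem_box i; exists (n + m)%N => s t st.
by apply: An; exact: agree_tau st.
Qed.

Lemma measurable_of_cylinder dT (T : measurableType dT) (h : T -> Omega d S) :
  (forall A, cylinder A -> measurable (h @^-1` A)) -> measurable_fun setT h.
Proof.
move=> hA; apply: (measurability _ (esym g_sigma_cylinder)) => _ [A cA <-].
by rewrite setTI; exact: hA.
Qed.

Lemma measurable_tau (i : 'rV[int]_d) : measurable_fun setT (@tau d S i).
Proof.
apply: measurable_of_cylinder => A cA; apply: measurable_cylinder.
exact: cylinder_tau.
Qed.

End Shifts.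

(** * Integrals of local functions *)

Section LocalFunctions.
Context {d : nat} {S : pointedType} {R : realType}.
Implicit Types (mu nu : probability (Omega d S) R) (f : Omega d S -> R).

Lemma Loc_measurable n f : Loc (box n) f -> measurable_fun setT f.
Proof.
move=> fn _ Y _; rewrite setTI; apply: measurable_cylinder.
by exists n => s t st; rewrite /preimage/= (fn s t).
Qed.

Lemma Loc_bounded_measurable n f (a : 'rV[int]_d -> R) : Loc (box n) f ->
  (forall i, osc i f <= (a i)%:E)%E -> bounded_measurable f.
Proof.
move=> fn fa; split; first exact: Loc_measurable fn.
have a0 i : 0 <= a i by rewrite -lee_fin (le_trans (osc_ge0 i f)).
have fst s t : f s - f t <= \sum_(i <- box_sites n) a i.
  apply: (le_trans (Loc_box_telescope s t fn fa)); apply: ler_sum => i _.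
  by case: (_ != _); rewrite ?mulr1 ?mulr0.
exists (`|f point| + \sum_(i <- box_sites n) a i) => s.
have := ler_norm (f point); have := ler_norm (- f point); rewrite normrN.
have := fst s point; have := fst point s; rewrite ler_norml; lra.
Qed.

Lemma le_DLoc p n f nu mu : Loc (box n) f -> bounded_measurable f ->
  (osc_norm (hoelder_conjugate p) f <= 1)%E ->
  ((\int[nu]_s f s - \int[mu]_s f s)%:E <= DLoc p (box n) nu mu)%E.
Proof.
move=> fn bf f1; rewrite EFinB -!integral_EFin//.
by apply: ereal_sup_ubound; exists f.
Qed.

(** Reduces upper bounds for all exponents to test functions whose oscillations have a controlled
    sum. *)
Lemma DLoc_le p n nu mu (x : R) : (1 <= p)%E ->
  (forall f a, Loc (box n) f -> bounded_measurable f ->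
    (forall i, osc i f <= (a i)%:E)%E ->
    \sum_(i <- box_sites n) a i <=
      (if p is r%:E then (size (@box_sites d n))%:R `^ r^-1 else 1) ->
    \int[nu]_s f s - \int[mu]_s f s <= x) ->
  (DLoc p (@box d n) nu mu <= x%:E)%E.
Proof.
move=> p1 H; apply: ge_ereal_sup => _ [f [fn f1] <-].
have [a fa aw] := osc_norm_box p1 fn f1.
have fa' i : (osc i f <= (a i)%:E)%E by rewrite fa.
have bf := Loc_bounded_measurable fn fa'.
by rewrite !integral_EFin// -EFinB lee_fin; exact: H aw.
Qed.

Lemma Rintegral_tau mu (i : 'rV[int]_d) f : translation_invariant mu ->
  bounded_measurable f -> \int[mu]_s f (tau i s) = \int[mu]_s f s.
Proof.
move=> mu_inv bf; apply: prob_Rintegral_comp => //; first exact: measurable_tau.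
by move=> A mA; exact: mu_inv.
Qed.

End LocalFunctions.

(** * Discrepancy bounds from an invariant coupling *)

Section CouplingBound.
Context {d : nat} {S : pointedType} {R : realType}.
Hypothesis finS : finite_set [set: S].

Definition differ (i : 'rV[int]_d) : set (Omega d S * Omega d S) :=
  [set x | x.1 i <> x.2 i].

Lemma measurable_differ i : measurable (differ i).
Proof.
pose E c := [set s : Omega d S | s i = c].
have mE c : measurable (E c).
  have [n ni] := mem_box i; apply: measurable_cylinder.
  by exists n => s t st; rewrite /E/= st.
(* Finiteness of [S] makes this a finite union of measurable rectangles. *)
rewrite (_ : differ i = \bigcup_(c in [set: S]) (E c `*` ~` E c)).
  apply: fin_bigcup_measurable => // c _; apply: measurableX => //.
  exact: measurableC.
apply/seteqP; split => -[s t] /=; first by move=> st; exists (s i) => //;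
  split => // /esym.
by move=> [c _ [/= <-]] + /esym.
Qed.

Variables (nu mu : probability (Omega d S) R).
Variable Pi : probability (Omega d S * Omega d S)%type R.
Hypothesis couplingPi : invariant_coupling nu mu Pi.

Lemma coupling_differ i : Pi (differ i) = Pi (differ 0).
Proof.
case: couplingPi => _ _ /(_ (- i) (differ 0) (measurable_differ 0)) <-.
congr (Pi _); apply/seteqP; split => x /=;
  by rewrite /differ /tau/= opprK add0r.
Qed.

Lemma coupling_Rintegral n f (a : 'rV[int]_d -> R) : Loc (box n) f ->
  (forall i, osc i f <= (a i)%:E)%E ->
  \int[nu]_s f s - \int[mu]_s f s <=
    fine (Pi (differ 0)) * \sum_(i <- box_sites n) a i.
Proof.
move=> fn fa; have bf := Loc_bounded_measurable fn fa.
case: (couplingPi) => Pi1 Pi2 _.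
have bf1 := bounded_measurable_comp (@measurable_fst _ _ (Omega d S) (Omega d
  S)) bf.
have bf2 := bounded_measurable_comp (@measurable_snd _ _ (Omega d S) (Omega d
  S)) bf.
rewrite -(prob_Rintegral_comp measurable_fst Pi1 bf).
rewrite -(prob_Rintegral_comp measurable_snd Pi2 bf) -prob_RintegralB//.
have bd i : bounded_measurable (fun x => a i * (\1_(differ i) x : R)).
  apply/bounded_measurableZ/bounded_measurable_indic.
  exact: measurable_differ.
apply: (@le_trans _ _ (\int[Pi]_x \sum_(i <- box_sites n) a i * (\1_(differ i)
  x : R))).
  apply: le_prob_Rintegral.
  - exact: bounded_measurableB.
  - exact: bounded_measurable_sum.
  - move=> x; apply: (le_trans (Loc_box_telescope x.1 x.2 fn fa)).
    apply: ler_sum => i _; rewrite indicE.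
    have [xi|/eqP xi] := eqVneq (x.1 i) (x.2 i).
      by rewrite memNset//; move=> /(_ xi).
    by rewrite mem_set.
rewrite prob_Rintegral_sum// mulr_sumr; apply: ler_sum => i _.
rewrite prob_RintegralZ; last first.
  by apply: bounded_measurable_indic; exact: measurable_differ.
rewrite mulrC -[X in X * _]/(fine (\int[Pi]_x (\1_(differ i) x : R))%:E).
by rewrite prob_Rintegral_indic ?coupling_differ//; exact: measurable_differ.
Qed.

Lemma DLoc_coupling p n : (1 <= p)%E ->
  (DLoc p (@box d n) nu mu <= (fine (Pi (differ 0)) *
    (if p is r%:E then (size (@box_sites d n))%:R `^ r^-1 else 1))%:E)%E.
Proof.
move=> p1; apply: DLoc_le => // f a fn bf fa aw.
apply: (le_trans (coupling_Rintegral fn fa)).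
by rewrite ler_wpM2l// fine_ge0.
Qed.

End CouplingBound.

(** * The limit for [p = +oo] *)

(** Each entry of [r] is counted at most once because [s] has no repetition. This bounds the total
    oscillation of a Hamming-type cost whose sites may repeat. *)
Lemma sum_count_mem_le (T : eqType) (r s : seq T) : uniq s ->
  (\sum_(i <- s) count_mem i r <= size r)%N.
Proof.
move=> us; elim: r => [|j r IH]; first by rewrite big1.
rewrite /= big_split/= -add1n leq_add//.
apply: leq_trans (leq_b1 (j \in s)); rewrite -count_uniq_mem// -sum1_count.
by rewrite [leqRHS]big_mkcond/=; apply: leq_sum => i _; rewrite eq_sym;
  case: eqP.
Qed.

Section SupremumOfDiscrepancies.
Context {d : nat} {S : pointedType} {R : realType}.

Lemma cylinder_unique (P Q : probability (Omega d S) R) :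
  (forall A, cylinder A -> P A = Q A) -> forall A, measurable A -> P A = Q A.
Proof.
move=> PQ A mA; apply: (@g_sigma_algebra_measure_unique _ _ _ cylinder _ (fun=>
  setT)).
- by move=> B; exact: measurable_cylinder.
- by move=> _; exact: cylinderT.
- exact: bigcup_const.
- exact: cylinderI.
- exact: PQ.
- by move=> _; rewrite (le_lt_trans (probability_le1 P measurableT))// ltry.
- by rewrite g_sigma_cylinder.
Qed.

Variables nu mu : probability (Omega d S) R.

Lemma DLocy_nondecreasing :
  nondecreasing_seq (fun n => DLoc +oo%E (@box d n) nu mu).
Proof.
move=> m n mn; apply: le_ereal_sup => _ [f [fm f1] <-]; exists f => //.
by split => // s t st; apply: fm => j /(box_le mn); exact: st.
Qed.

Lemma Dy_sup : D +oo%E nu mu = ereal_sup (range (fun n => DLoc +oo%E (@box d n)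
  nu mu)).
Proof. exact/cvg_lim/ereal_nondecreasing_cvgn/DLocy_nondecreasing. Qed.

Lemma DLocy_le n : (DLoc +oo%E (@box d n) nu mu <= D +oo%E nu mu)%E.
Proof. by rewrite Dy_sup; apply: ereal_sup_ubound; exists n. Qed.

Lemma osc_cst i (r : R) : osc i (fun _ : Omega d S => r) = 0%E.
Proof. by apply: (@osc_outside _ _ _ set0) => // [s t _|[]]. Qed.

(** The value lies in [[0, 1]]: the zero function is admissible, and a total oscillation of at most
    1 forces [f s - f t <= 1] for all [s] and [t]. *)
Lemma Dy_fin_num : D +oo%E nu mu \is a fin_num.
Proof.
rewrite ge0_fin_numE.
  apply: (@le_lt_trans _ _ 1%E); last exact: ltry.
  rewrite Dy_sup; apply: ge_ereal_sup => _ [n _ <-].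
  apply: (DLoc_le (leey 1)) => f a fn bf fa a1.
  have a0 i : 0 <= a i by rewrite -lee_fin (le_trans (osc_ge0 i f)).
  have fst s t : f s - f t <= 1.
    apply: (le_trans (Loc_box_telescope s t fn fa)); apply: le_trans a1.
    apply: ler_sum => i _.
    by case: (_ != _); rewrite ?mulr1 ?mulr0.
  have nuf t : \int[nu]_s f s <= f t + 1.
    rewrite -[leRHS](prob_Rintegral_cst nu); apply: le_prob_Rintegral => //.
      exact: bounded_measurable_cst.
    by move=> s; rewrite -lerBlDl.
  rewrite lerBlDl -[leLHS](prob_Rintegral_cst mu).
  have -> : \int[mu]_s f s + 1 = \int[mu]_s (f s + 1) :> R.
    rewrite prob_RintegralD ?prob_Rintegral_cst//.
    exact: bounded_measurable_cst.
  apply: le_prob_Rintegral => //; first exact: bounded_measurable_cst.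
  by apply: bounded_measurableD => //; exact: bounded_measurable_cst.
apply: le_trans (DLocy_le 0).
rewrite -[0%E]/(0%:E) -(subrr (\int[nu]_s (0:R))).
have -> : (\int[nu]_s 0 - \int[nu]_s 0 = \int[nu]_s 0 - \int[mu]_s 0 :> R).
  by rewrite !prob_Rintegral_cst.
apply: le_DLoc => //; first exact: bounded_measurable_cst.
rewrite hoelder_conjugatey /osc_norm invr1 esum1 ?poweRe1//.
by move=> i _; rewrite osc_cst poweRe1.
Qed.

Lemma seq_in_box (r : seq 'rV[int]_d) : exists n, forall i, i \in r -> box n i.
Proof.
elim: r => [|i r [n rn]]; first by exists 0%N.
have [m mi] := mem_box i; exists (maxn m n) => j;
  rewrite inE => /predU1P[->|/rn].
  exact: box_le (leq_maxl _ _) _ mi.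
by apply: box_le; exact: leq_maxr.
Qed.

(** The oscillations of [f] sum to at most [b * size r], so [f] divided by this constant is
    admissible in the supremum defining [D +oo]. *)
Lemma Rintegral_hamming_le (b : R) (r : seq 'rV[int]_d) (f : Omega d S -> R) :
  0 <= b ->
  (forall s t, f s - f t <= b * \sum_(i <- r) (s i != t i)%:R) ->
  bounded_measurable f /\
  \int[nu]_s f s - \int[mu]_s f s <= b * (size r)%:R * fine (D +oo%E nu mu).
Proof.
move=> b0 fb; have [n rn] := seq_in_box r.
have fn : Loc (box n) f.
  have fle s t : (forall j, box n j -> s j = t j) -> f s <= f t.
    move=> st; rewrite -subr_le0 (le_trans (fb _ _))// big_seq big1 ?mulr0//.
    by move=> i /rn /st ->; rewrite eqxx.
  by move=> s t st; apply/eqP; rewrite eq_le !fle// => j /st.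
have osc_f i : (osc i f <= (b * (count_mem i r)%:R)%:E)%E.
  apply: osc_le => s t st; apply: (le_trans (fb s t)); rewrite ler_wpM2l//.
  rewrite -sum1_count natr_sum [leRHS]big_mkcond/=; apply: ler_sum => j _.
  by have [//|/st ->] := eqVneq j i; [case: (_ != _)|rewrite eqxx].
have bf := Loc_bounded_measurable fn osc_f.
split => //; set c := b * (size r)%:R.
have c0 : 0 <= c by rewrite mulr_ge0.
have fc s t : f s - f t <= c.
  apply: (le_trans (fb s t)); rewrite ler_wpM2l// -sum1_size natr_sum.
  by apply: ler_sum => i _; case: (_ != _).
(* When [c = 0] the division is impossible, but then [f] is constant. *)
move: c0; rewrite le_eqVlt => /predU1P[c0|c0].
  rewrite -c0 mul0r.
  have fle s t : f s <= f t by rewrite -subr_le0 c0.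
  have fE : f = fun=> f point by apply/funext => s; apply/eqP;
    rewrite eq_le !fle.
  by rewrite fE !prob_Rintegral_cst subrr.
have r0 : 0 < (size r)%:R :> R.
  by move: c0; rewrite /c; case: (size r) => [|k] //; rewrite mulr0 ltxx.
have bcf := bounded_measurableZ c^-1 bf.
have : ((\int[nu]_s (c^-1 * f s) - \int[mu]_s (c^-1 * f s))%:E <=
    DLoc +oo%E (box n) nu mu)%E.
  apply: le_DLoc => //; first by move=> s t /fn ->.
  rewrite hoelder_conjugatey /osc_norm invr1 poweRe1; last first.
    by apply: esum_ge0 => i _; exact: poweR_ge0.
  apply: ge_ereal_sup => _ [X [finX _] <-]; rewrite fsbig_finite//=.
  apply: (@le_trans _ _ (\sum_(i <- fset_set X) ((count_mem i r)%:R / (size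
    r)%:R))%:E).
    rewrite -sumEFin; apply: lee_sum => i _; rewrite poweRe1 ?osc_ge0//.
    apply: osc_le => s t st; rewrite -mulrBr ler_pdivrMl//.
    rewrite /c mulrACA divff ?gt_eqF// ?mulr1.
    by rewrite -lee_fin (le_trans _ (osc_f i))//; exact: osc_ge.
  rewrite -mulr_suml lee_fin ler_pdivrMr ?mul1r//.
  rewrite -natr_sum ler_nat.
  exact/sum_count_mem_le/fset_uniq.
move/le_trans => /(_ _ (DLocy_le n)).
rewrite -(fineK Dy_fin_num) lee_fin !prob_RintegralZ// -mulrBr.
by rewrite ler_pdivrMl.
Qed.

End SupremumOfDiscrepancies.

(** * The cone of the coupling problem *)

Section CouplingConstruction.
Context {d : nat} {S : pointedType} {R : realType}.

(** A pair of configurations is encoded as one configuration over the alphabet [S * S], so that the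
    results on cylinders apply to it directly. *)
Definition left_config (x : Omega d (S * S)%type) : Omega d S :=
  fun i => (x i).1.
Definition right_config (x : Omega d (S * S)%type) : Omega d S :=
  fun i => (x i).2.
Definition origin_differs (x : Omega d (S * S)%type) : R :=
  ((x 0).1 != (x 0).2)%:R.

Lemma cylinder_left (A : set (Omega d S)) :
  cylinder A -> cylinder (left_config @^-1` A).
Proof.
move=> [n An]; exists n => x y xy; apply: An => j nj.
by rewrite /left_config xy.
Qed.

Lemma measurable_left_config : measurable_fun setT left_config.
Proof.
apply: measurable_of_cylinder => A cA; apply: measurable_cylinder.
exact: cylinder_left.
Qed.

Lemma cylinder_right (A : set (Omega d S)) :
  cylinder A -> cylinder (right_config @^-1` A).
Proof.
move=> [n An]; exists n => x y xy; apply: An => j nj.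
by rewrite /right_config xy.
Qed.

Lemma measurable_right_config : measurable_fun setT right_config.
Proof.
apply: measurable_of_cylinder => A cA; apply: measurable_cylinder.
exact: cylinder_right.
Qed.

Variables nu mu : probability (Omega d S) R.
Hypothesis nu_inv : translation_invariant nu.
Hypothesis mu_inv : translation_invariant mu.

Let Dy := fine (D +oo%E nu mu).

(** Integrated against an invariant coupling with disagreement probability at most [Dy], the
    inequalities force a bounded measurable [g] to have integral at most 0: the cone collects the
    constraints on such a coupling. Requiring [r] to be nonempty keeps the condition from being
    vacuous. *)
Definition coupling_cone : set (Omega d (S * S)%type -> R) :=
  [set g | exists (r : seq 'rV[int]_d) (u v : Omega d S -> R) (a : R),
    [/\ r != [::], bounded_measurable u /\ bounded_measurable v, 0 <= a,
      forall x, \sum_(i <- r) (g (tau i x) - a * origin_differs (tau i x)) <=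
        u (left_config x) + v (right_config x) &
      \int[nu]_s u s + \int[mu]_s v s + (size r)%:R * (a * Dy) <= 0]].

Lemma coupling_cone_npos g : (forall x, g x <= 0) -> coupling_cone g.
Proof.
move=> g0; exists [:: 0], (fun=> 0), (fun=> 0), 0.
split => //; first by split; exact: bounded_measurable_cst.
  by move=> x; rewrite big_seq1 mul0r subr0 addr0.
by rewrite !prob_Rintegral_cst mul0r mulr0 !addr0.
Qed.

(** The sums [i + j] serve both functions at once: add the inequality for [g] translated along [r']
    to the one for [h] translated along [r]. By invariance of [nu] and [mu], the integrals only pick
    up the factors [size r'] and [size r]. *)
Lemma coupling_coneD g h : coupling_cone g -> coupling_cone h ->
  coupling_cone (g + h).
Proof.
move=> [r [u [v [a [r0 [bu bv] a0 guv uv0]]]]].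
move=> [r' [u' [v' [a' [r'0 [bu' bv'] a'0 huv uv'0]]]]].
pose w (u u' : Omega d S -> R) s :=
  \sum_(j <- r') u (tau j s) + \sum_(i <- r) u' (tau i s).
have bt f i : bounded_measurable f -> bounded_measurable (fun s : Omega d S =>
  f (tau i s) : R).
  by move=> bf; exact: bounded_measurable_comp (measurable_tau i) bf.
have bw f f' : bounded_measurable f -> bounded_measurable f' ->
    bounded_measurable (w f f').
  by move=> bf bf'; apply: bounded_measurableD;
    apply: bounded_measurable_sum => i;
    exact: bt.
have Ew (P : probability (Omega d S) R) f f' : translation_invariant P ->
    bounded_measurable f -> bounded_measurable f' ->
    \int[P]_s w f f' s = (size r')%:R * \int[P]_s f s + (size r)%:R * \int[P]_s
      f' s.
  move=> P_inv bf bf'; rewrite prob_RintegralD;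
    try by apply: bounded_measurable_sum => i; exact: bt.
  rewrite !prob_Rintegral_sum; try by move=> i; exact: bt.
  congr (_ + _); rewrite -sum1_size natr_sum mulr_suml; apply: eq_bigr => i _;
    by rewrite Rintegral_tau// mul1r.
exists [seq i + j | i <- r, j <- r'], (w u u'), (w v v'), (a + a'); split.
- by rewrite -size_eq0 size_allpairs muln_eq0 !size_eq0 negb_or r0.
- by split; exact: bw.
- exact: addr_ge0.
- move=> x; rewrite big_allpairs_dep/=.
  rewrite (_ : \sum_(i <- r) _ =
     \sum_(j <- r') \sum_(i <- r) (g (tau i (tau j x)) - a * origin_differs
       (tau i (tau j x)))
     + \sum_(i <- r) \sum_(j <- r') (h (tau j (tau i x)) - a' * origin_differs
       (tau j (tau i x)))).
    rewrite /w addrACA -!big_split/=; apply: lerD; apply: ler_sum => i _.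
      exact: guv.
    exact: huv.
  rewrite [X in _ = X + _]exchange_big/= -big_split/=; apply: eq_bigr => i _.
  rewrite -big_split/=; apply: eq_bigr => j _.
  by rewrite !tauD [j + i]addrC fctE; ring.
- rewrite !Ew// size_allpairs natrM.
  rewrite [leLHS](_ : _ = (size r')%:R * (\int[nu]_s u s + \int[mu]_s v s +
    (size r)%:R * (a * Dy))
    + (size r)%:R * (\int[nu]_s u' s + \int[mu]_s v' s + (size r')%:R * (a' *
      Dy))).
    by rewrite -[leRHS]addr0 lerD// mulr_ge0_le0.
  by ring.
Qed.

Lemma coupling_cone_convex : convex_cone coupling_cone.
Proof.
split; [exact: coupling_cone_npos|exact: coupling_coneD|].
move=> t g t0 [r [u [v [a [r0 [bu bv] a0 guv uv0]]]]].
exists r, (fun s => t * u s), (fun s => t * v s), (t * a); split => //.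
- by split; exact: bounded_measurableZ.
- exact: mulr_ge0.
- move=> x; rewrite -mulrDr; apply: le_trans (ler_wpM2l t0 (guv x)).
  rewrite mulr_sumr; apply: ler_sum => i _.
  by rewrite mulrBr mulrA.
- rewrite !prob_RintegralZ// [leLHS](_ : _ = t * (\int[nu]_s u s + \int[mu]_s v
  s + (size r)%:R * (a * Dy))).
    by rewrite mulr_ge0_le0.
  by ring.
Qed.

Definition pair_config (s t : Omega d S) : Omega d (S * S)%type := fun i => (s
  i, t i).

Lemma coupling_cone_proper : ~ coupling_cone (cst 1).
Proof.
move=> [r [u [v [a [r0 [bu bv] a0 guv]]]]]; apply/negP; rewrite -ltNge.
have [v_meas [M vM]] := bv.
(* The origin of [tau i x] is the site [- i] of [x], whence the signs. *)
pose H (s t : Omega d S) : R := a * \sum_(i <- r) (s (- i) != t (- i))%:R.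
have H0 s t : 0 <= H s t by rewrite mulr_ge0// sumr_ge0.
pose V s := [set v t + H s t | t in [set: Omega d S]].
have lbV s : has_lbound (V s).
  exists (- M) => _ [t _ <-]; rewrite -[leLHS]addr0 lerD//.
  by have := vM t; rewrite ler_norml => /andP[].
have V0 s : V s !=set0 by exists (v s + H s s); exists s.
(* the inf-convolution of [v] with the Hamming-type cost [H] *)
pose f s := inf (V s).
have fv s : f s <= v s.
  apply: ge_inf => //; exists s => //; rewrite /H big1 ?mulr0 ?addr0// => i _.
  by rewrite eqxx.
have uf s : (size r)%:R - u s <= f s.
  apply: lb_le_inf => // _ [t _ <-]; rewrite lerBlDr addrAC -lerBlDr.
  have := guv (pair_config s t); rewrite addrC; apply: le_trans.
  rewrite big_split/= -sum1_size natr_sum lerD2l sumrN lerN2 /H mulr_sumr.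
  apply: ler_sum => i _; rewrite /origin_differs /tau/= sub0r.
  by [].
(* The triangle inequality for the Hamming-type cost passes to the infimum. *)
have flip s s' : f s - f s' <= a * \sum_(i <- [seq - i | i <- r]) (s i != s'
  i)%:R.
  rewrite big_map lerBlDr -lerBlDl; apply: lb_le_inf => // _ [t _ <-].
  rewrite lerBlDl; apply: (@le_trans _ _ (v t + H s t)).
    by apply: ge_inf => //; exists t.
  rewrite addrCA lerD2l /H -mulrDr ler_wpM2l// -big_split/=.
  apply: ler_sum => i _; rewrite -natrD ler_nat.
  have [->|_] := eqVneq (s (- i)) (s' (- i)); first by [].
  exact: leq_trans (leq_b1 _) (leq_addr _ _).
have [bf fD] := Rintegral_hamming_le nu mu a0 flip.
(* With [fD] and [muv], this bounds [size r] by the integral of [u] plus that of [v] plus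
   [size r * (a * Dy)], so this sum is positive. *)
have nuu : (size r)%:R - \int[nu]_s u s <= \int[nu]_s f s.
  rewrite -[X in X - _](prob_Rintegral_cst nu) -prob_RintegralB//.
    by apply: le_prob_Rintegral => //; apply: bounded_measurableB => //;
      exact: bounded_measurable_cst.
  exact: bounded_measurable_cst.
have muv : \int[mu]_s f s <= \int[mu]_s v s by exact: le_prob_Rintegral.
have sr : 0 < (size r)%:R :> R by rewrite ltr0n lt0n size_eq0.
rewrite size_map in fD; rewrite -/Dy in fD.
have : a * (size r)%:R * Dy = (size r)%:R * (a * Dy) by ring.
lra.
Qed.

End CouplingConstruction.

(** * An optimal coupling *)

Section OptimalCoupling.
Context {d : nat} {S : pointedType} {R : realType}.
Variables nu mu : probability (Omega d S) R.
Hypothesis finS : finite_set [set: S].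
Hypothesis nu_inv : translation_invariant nu.
Hypothesis mu_inv : translation_invariant mu.

Let T2 := Omega d (S * S)%type.
Let C : set (T2 -> R) := coupling_cone nu mu.
Let e : T2 -> R := cst 1.
Let Dy := fine (D +oo%E nu mu).

Lemma coupling_cone_bounded (g : T2 -> R) (M : R) : (forall x, `|g x| <= M) ->
  order_bounded C e g.
Proof.
move=> gM; exists M; apply: coupling_cone_npos => x;
  rewrite !fctE/= -[_ *: _]/(M * 1) mulr1.
  by have := gM x; rewrite ler_norml => /andP[_]; rewrite subr_le0.
by have := gM x; rewrite ler_norml => /andP[+ _]; rewrite subr_le0 lerNl.
Qed.

(** Bounds the functional at [u \o left_config] by the integral of [u]. Used for an indicator and
    for its complement, it fixes the left marginal. *)
Lemma coupling_cone_left u : bounded_measurable u ->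
  C ((u \o left_config) - (\int[nu]_s u s) *: e).
Proof.
move=> bu; exists [:: 0], (fun s => u s - \int[nu]_s u s), (fun=> 0), 0;
  split => //.
- split; last exact: bounded_measurable_cst.
  by apply: bounded_measurableB => //; exact: bounded_measurable_cst.
- move=> x; rewrite big_seq1 tau0 mul0r subr0 addr0 !fctE/=.
  by rewrite -[_ *: _]/(_ * 1) mulr1.
- rewrite prob_RintegralB//; last exact: bounded_measurable_cst.
  by rewrite !prob_Rintegral_cst subrr mul0r mulr0 !addr0.
Qed.

Lemma coupling_cone_right v : bounded_measurable v ->
  C ((v \o right_config) - (\int[mu]_s v s) *: e).
Proof.
move=> bv; exists [:: 0], (fun=> 0), (fun s => v s - \int[mu]_s v s), 0;
  split => //.
- split; first exact: bounded_measurable_cst.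
  by apply: bounded_measurableB => //; exact: bounded_measurable_cst.
- move=> x; rewrite big_seq1 tau0 mul0r subr0 add0r !fctE/=.
  by rewrite -[_ *: _]/(_ * 1) mulr1.
- rewrite prob_RintegralB//; last exact: bounded_measurable_cst.
  by rewrite !prob_Rintegral_cst subrr mul0r mulr0 !addr0.
Qed.

(** The choice [a = 1] cancels the disagreement cost, and the constant [- Dy] pays for it; the
    functional at the disagreement indicator is thus at most [Dy]. *)
Lemma coupling_cone_differ : C (@origin_differs _ _ R - Dy *: e).
Proof.
exists [:: 0], (fun=> - Dy), (fun=> 0), 1; split => //.
- by split; exact: bounded_measurable_cst.
- move=> x; rewrite big_seq1 mul1r addr0 !fctE/= -[_ *: _]/(_ * 1) mulr1.
  by rewrite addrAC subrr add0r.
- by rewrite !prob_Rintegral_cst !mul1r addr0 -/Dy addNr.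
Qed.

(* The average of [g - g \o tau i] over the shifts by [0, i, ..., (N-1) i]
   telescopes. *)
Lemma coupling_cone_shift (g : T2 -> R) (M : R) i (eps : R) :
  (forall x, `|g x| <= M) -> 0 < eps -> C (g - (g \o tau i) - eps *: e).
Proof.
move=> gM eps0; have M0 : 0 <= M by apply: le_trans (gM point).
(* The telescoped boundary terms contribute at most [2 * M], which [N.+1] copies of [eps] absorb. *)
have [N MN] : exists N, 2 * M <= N.+1%:R * eps.
  exists (Num.truncn (2 * M / eps)); rewrite -ler_pdivrMr// ltW//.
  by rewrite truncnS_gt.
exists [seq i *+ k | k <- index_iota 0 N.+1], (fun=> 0), (fun=> 0), 0;
  split => //.
- by split; exact: bounded_measurable_cst.
- move=> x; rewrite big_map addr0.
  rewrite (eq_bigr (fun k : nat => (g (tau (i *+ k) x) - g (tau (i *+ k.+1) x))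
    - eps)).
    rewrite big_split/=.
    rewrite (telescope_sumr_eq (fun k => - g (tau (i *+ k) x)))//; last first.
      by move=> k _; rewrite opprK addrC.
    rewrite big_mkord sumr_const card_ord -mulr_natl mulr0n tau0.
    have := gM x; have := gM (tau (i *+ N.+1) x); rewrite !ler_norml.
    rewrite mulrN; lra.
  move=> k _; rewrite mul0r subr0 !fctE/= -[_ *: _]/(_ * 1) mulr1 tauD.
  by rewrite mulrS.
- by rewrite !prob_Rintegral_cst mul0r mulr0 !addr0.
Qed.

Lemma optimal_coupling :
  exists2 Pi : probability (Omega d S * Omega d S)%type R,
  invariant_coupling nu mu Pi & (Pi (differ 0%R) <= D +oo nu mu)%E.
Proof.
have CNe : C (- e) by apply: coupling_cone_npos => x; rewrite oppr_le0.
have [L [LD LC]] := cone_functional (coupling_cone_convex nu_inv mu_inv) CNe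
  (@coupling_cone_proper _ _ _ nu mu).
have bind (A : set T2) : order_bounded C e (\1_A).
  by apply: (@coupling_cone_bounded _ 1) => x; rewrite indicE;
    case: (_ \in _); rewrite ?normr1 ?normr0.
have b0 : order_bounded C e 0.
  by apply: (@coupling_cone_bounded _ 0) => x; rewrite normr0.
have bN g : order_bounded C e g -> order_bounded C e (- g).
  by move=> [c gc Ngc]; exists c; rewrite ?opprK.
have L0 : L 0 = 0 by apply: (addrI (L 0)); rewrite -LD// !addr0.
have LN g : order_bounded C e g -> L (- g) = - L g.
  by move=> bg; apply: (addrI (L g)); rewrite -LD ?subrr//; exact: bN.
(* [m] is finitely additive on all sets; only its values on cylinders enter the extension to a
   measure. *)
pose m A := L (\1_A).
have m0 A : 0 <= m A.
  rewrite -oppr_le0 -LN; last exact: bind.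
  apply: LC; first exact: (bN _ (bind A)).
  apply: coupling_cone_npos => x; rewrite scale0r subr0 !fctE/= indicE.
  by rewrite oppr_le0.
have mT : m setT = 1.
  have m1 : \1_setT = e :> (T2 -> R) by apply/funext => x;
    rewrite indicE in_setT.
  have be : order_bounded C e e.
    by apply: (@coupling_cone_bounded _ 1) => x; rewrite normr1.
  apply/eqP; rewrite eq_le /m m1; apply/andP; split.
    by apply: LC => //; rewrite scale1r subrr; exact: coupling_cone_npos.
  rewrite -lerN2 -LN//; apply: LC; first exact: bN.
  by rewrite scaleN1r subrr; exact: coupling_cone_npos.
have mU A B : A `&` B = set0 -> m (A `|` B) = m A + m B.
  move=> AB; rewrite /m -LD; [congr L|exact: bind|exact: bind];
    apply/funext => x.
  rewrite !fctE !indicE in_setU.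
  have [xA|xA] := boolP (x \in A); have [xB|xB] := boolP (x \in B);
    rewrite ?addr0 ?add0r//.
  by have : (A `&` B) x by [split; exact/set_mem]; rewrite AB.
have finSS : finite_set [set: (S * S)%type].
  by rewrite -setXTT; exact: finite_setX.
have [P PE] := cylinder_extension finSS m0 mT mU.
have Lindic (g : T2 -> R) A c : (\1_A : T2 -> R) = g ->
    C (g - c *: e) -> m A <= c.
  by move=> <- gc; apply: LC gc; exact: bind.
pose pr (x : T2) := (left_config x, right_config x).
have mpr : measurable_fun setT pr
  by apply: measurable_fun_pair;
    [exact: measurable_left_config|exact: measurable_right_config].
pose prm : {mfun T2 >-> (Omega d S * Omega d S)%type} :=
  HB.pack pr (isMeasurableFun.Build _ _ _ _ _ mpr).
pose lm : {mfun T2 >-> Omega d S} :=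
  HB.pack (left_config : T2 -> Omega d S) (isMeasurableFun.Build _ _ _ _ _
    measurable_left_config).
pose rm : {mfun T2 >-> Omega d S} :=
  HB.pack (right_config : T2 -> Omega d S) (isMeasurableFun.Build _ _ _ _ _
    measurable_right_config).
pose tm i : {mfun T2 >-> T2} :=
  HB.pack (@tau d (S * S)%type i : T2 -> T2)
    (isMeasurableFun.Build _ _ _ _ _ (@measurable_tau d (S * S)%type i)).
have mC A : m (~` A) = 1 - m A.
  apply/eqP; rewrite -subr_eq opprK -mT -(setUv A) mU ?setICr//.
  by rewrite addrC.
(* The cone yields only upper bounds; one for a set and one for its complement determine the
   value. *)
have pinch (A : set T2) (c : R) : m A <= c -> m (~` A) <= 1 - c -> m A = c.
  by rewrite mC => Ac cA; apply/eqP; rewrite eq_le Ac/=; move: cA; lra.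
have P_left A : measurable A -> P (left_config @^-1` A) = nu A.
  apply: (@cylinder_unique _ _ _ (distribution P lm) nu) => {}A cA.
  rewrite -[LHS]/(P (left_config @^-1` A)) PE; last exact: cylinder_left.
  have mA := measurable_cylinder cA.
  rewrite -prob_Rintegral_indic//; congr EFin; apply: pinch.
    apply: (Lindic _ _ _ erefl).
    exact: (coupling_cone_left (bounded_measurable_indic mA)).
  rewrite -prob_Rintegral_indicC//; apply: (Lindic _ _ _ erefl).
  apply: (coupling_cone_left (bounded_measurable_indic _)).
  exact: measurableC.
have P_right A : measurable A -> P (right_config @^-1` A) = mu A.
  apply: (@cylinder_unique _ _ _ (distribution P rm) mu) => {}A cA.
  rewrite -[LHS]/(P (right_config @^-1` A)) PE; last exact: cylinder_right.
  have mA := measurable_cylinder cA.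
  rewrite -prob_Rintegral_indic//; congr EFin; apply: pinch.
    apply: (Lindic _ _ _ erefl).
    exact: (coupling_cone_right (bounded_measurable_indic mA)).
  rewrite -prob_Rintegral_indicC//; apply: (Lindic _ _ _ erefl).
  apply: (coupling_cone_right (bounded_measurable_indic _)).
  exact: measurableC.
have P_tau i A : measurable A -> P (tau i @^-1` A) = P A.
  apply: (@cylinder_unique _ _ _ (distribution P (tm i)) P) => {}A cA.
  rewrite -[LHS]/(P (tau i @^-1` A)) !PE//; last exact: cylinder_tau.
  (* One inequality comes from the cone after letting [eps] vanish; applied to complements it gives
     the reverse one. *)
  have m_tau B : m B <= m (tau i @^-1` B).
    rewrite -subr_le0 -LN; last exact: bind.
    rewrite -LD; [|exact: bind|exact: (bN _ (bind _))].
    apply/ler_addgt0Pr => eps eps0; rewrite add0r; apply: LC.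
      apply: (@coupling_cone_bounded _ 2) => x.
      rewrite !fctE !indicE; do 2 case: (_ \in _); rewrite ler_norml/=; lra.
    apply: (@coupling_cone_shift _ 1) => // x.
    by rewrite indicE; case: (_ \in _); rewrite ?normr1 ?normr0.
  congr EFin; apply/eqP; rewrite eq_le m_tau andbT.
  by have := m_tau (~` A); rewrite preimage_setC !mC; lra.
exists (distribution P prm).
  split => [A mA|A mA|i A mA].
  - exact: P_left.
  - exact: P_right.
  - have mA' : measurable (pr @^-1` A) by rewrite -[X in measurable X]setTI;
    exact: (mpr measurableT A mA).
    exact: (P_tau i _ mA').
(* Disagreement at the origin pulls back to a cylinder, so its probability is the value of [m]. *)
rewrite -[X in (X <= _)%E]/(P (pr @^-1` differ 0)) PE; last first.
  have [n n0] := @mem_box d 0; exists n => x y xy.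
  by rewrite /differ /preimage/= /left_config /right_config xy.
rewrite -(fineK (Dy_fin_num nu mu)) lee_fin.
apply: (Lindic (@origin_differs _ _ R)); last exact: coupling_cone_differ.
apply/funext => x; rewrite indicE /origin_differs; congr (nat_of_bool _)%:R.
by apply/idP/idP => [/set_mem/eqP|/eqP ?]; last exact/mem_set.
Qed.

End OptimalCoupling.

(** * Averaging over shifts *)

Lemma size_box_sites (d n : nat) : size (@box_sites d n) = ((2 * n).+1 ^ d)%N.
Proof.
rewrite -[in RHS](card_ord (2 * n).+1) -[in RHS](card_ord d) -card_ffun cardE.
rewrite -(size_map (@box_point d n)); apply/perm_size/uniq_perm.
- exact: fset_uniq.
- by rewrite map_inj_uniq ?enum_uniq//; exact: box_point_inj.
- move=> i; rewrite mem_box_sites -range_box_point.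
  apply/idP/mapP => [/set_mem[v _ <-]|[v _ ->]]; first by exists v;
    rewrite ?mem_enum.
  by apply/mem_set; exists v.
Qed.

Section LowerBound.
Context {d : nat} {S : pointedType} {R : realType}.
Variables nu mu : probability (Omega d S) R.
Hypothesis nu_inv : translation_invariant nu.
Hypothesis mu_inv : translation_invariant mu.

Let vol n : R := (size (@box_sites d n))%:R.

Lemma vol_gt0 n : 0 < vol n.
Proof. by rewrite /vol size_box_sites ltr0n expn_gt0. Qed.

Lemma vol_ratio_cvg n : vol N / vol (N + n) @[N --> \oo] --> (1 : R).
Proof.
(* The ratio of side lengths, [(2N + 1) / (2(N + n) + 1)]; the volume ratio is its [d]-th power. *)
pose q N : R := 1 - (2 * n)%:R / (2 * (N + n)).+1%:R.
have -> : (fun N => vol N / vol (N + n)) = (fun N => q N ^+ d).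
  apply/funext => N; rewrite /vol !size_box_sites !natrX -exprVn -exprMn;
    congr (_ ^+ _).
  rewrite /q -[X in X - _](@divff _ (2 * (N + n)).+1%:R) ?pnatr_eq0//.
  rewrite -mulrBl; congr (_ / _); rewrite -natrB; last lia.
  by congr _%:R; lia.
have q1 : q N @[N --> \oo] --> (1 : R).
  rewrite -[X in _ --> X]subr0; apply: cvgB; first exact: cvg_cst.
  rewrite -(mulr0 (2 * n)%:R); apply: cvgM; first exact: cvg_cst.
  apply: (@squeeze_cvgr _ _ _ _ (fun=> 0) harmonic); last 2 first.
  - exact: cvg_cst.
  - exact: cvg_harmonic.
  apply: nearW => N; rewrite invr_ge0 ler0n/= lef_pV2 ?posrE ?ltr0n// ler_nat.
  lia.
elim: d => [|k IH].
  by under eq_fun do rewrite expr0; exact: cvg_cst.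
under eq_fun do rewrite exprS.
by rewrite -(mulr1 1); exact: cvgM.
Qed.

Definition shift_sum N (f : Omega d S -> R) : Omega d S -> R :=
  fun s => \sum_(i <- box_sites N) f (tau i s).

(** Changing [s] at [j] changes [tau i s] at [j + i] only, so the oscillations involved are those of
    [f] at distinct sites [j + i], whose sum is at most 1. *)
Lemma osc_shift_sum n N (f : Omega d S -> R) :
  Loc (box n) f -> (osc_norm 1 f <= 1)%E ->
  forall j, (osc j (shift_sum N f) <= 1%:E)%E.
Proof.
move=> fn f1 j; have := osc_norm_fin (lexx 1) f1; rewrite -[1%R]/(1:R) => f1'.
have f1'' : (\esum_(i in [set: 'rV[int]_d]) osc (j + i) f <= 1)%E.
  rewrite -(reindex_esum setT setT (fun i => j + i) (fun i => osc i f))//.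
  apply: le_trans f1'; apply: le_esum => i _.
  by rewrite poweRe1// osc_ge0.
have osc1 i : (osc (j + i) f <= 1)%E.
  apply: le_trans f1''; apply: esum_ge; exists [set i];
    last by rewrite fsbig_set1.
  by split => //; exact: finite_set1.
have oscf i : osc (j + i) f \is a fin_num.
  by rewrite ge0_fin_numE ?osc_ge0// (le_lt_trans (osc1 i))// ltry.
have sum1 : \sum_(i <- box_sites N) fine (osc (j + i) f) <= 1.
  rewrite -lee_fin (le_trans _ f1'')//; apply: esum_ge; exists (box N).
    by split => //; exact: finite_box.
  rewrite fsbig_finite//=; last exact: finite_box.
  by rewrite -sumEFin; apply: lee_sum => i _; rewrite fineK.
apply: osc_le => s t st; apply: le_trans sum1.
rewrite -sumrB; apply: ler_sum => i _; rewrite -lee_fin fineK//.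
apply: osc_ge => k kji; rewrite /tau; apply: st.
by apply: contra_neq kji => <-; rewrite subrK.
Qed.

(** The factor is the volume to the power [- 1 / q], with [q] conjugate to [r]. The oscillations are
    at most this factor and vanish outside [box (N + n)], so their [q]-th powers sum to at most
    1. *)
Lemma osc_norm_shift_sum n N (r : R) (f : Omega d S -> R) : 1 <= r ->
  Loc (box n) f -> (osc_norm 1 f <= 1)%E ->
  (osc_norm (hoelder_conjugate r%:E)
     (fun s => (vol (N + n) `^ (1 - r^-1))^-1 * shift_sum N f s)%R <= 1)%E.
Proof.
move=> r1 fn f1; set c := (vol (N + n) `^ (1 - r^-1))^-1; set G := fun s => _.
have r0 : 0 < r by rewrite (lt_le_trans _ r1).
have c0 : 0 < c by rewrite invr_gt0 powR_gt0// vol_gt0.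
have oscG j : (osc j G <= c%:E)%E.
  apply: osc_le => s t st;
    rewrite /G -mulrBr -[leRHS]mulr1 ler_wpM2l ?(ltW c0)//.
  rewrite -lee_fin; apply: le_trans (osc_shift_sum N fn f1 j).
  exact: osc_ge.
have GN : Loc (box (N + n)) G.
  move=> s t st; rewrite /G; congr (_ * _); rewrite /shift_sum !big_seq.
  apply: eq_bigr => i; rewrite mem_box_sites => /set_mem Ni; apply: fn.
  by apply: agree_tau Ni _; rewrite addnC.
have oscGfin j : osc j G \is a fin_num.
  by rewrite ge0_fin_numE ?osc_ge0// (le_lt_trans (oscG j))// ltry.
move: r1; rewrite le_eqVlt => /predU1P[r1|r1].
  rewrite -r1 hoelder_conjugate1/=; apply: ge_ereal_sup => _ [j _ <-].
  by apply: le_trans (oscG j) _; rewrite /c -r1 invr1 subrr powRr0 invr1.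
have r1' : 0 < r - 1 by rewrite subr_gt0.
rewrite (hoelder_conjugate_fin r1); set q := r / (r - 1);
  have q0 : 0 < q by rewrite divr_gt0.
have cq : c `^ q = (vol (N + n))^-1.
  rewrite /c -powRN -powRrM (_ : - (1 - r^-1) * q = -1) ?powR_inv1 ?ltW
    ?vol_gt0//.
  by rewrite /q; field; rewrite !gt_eqF.
rewrite /osc_norm -[leRHS](poweR1r q^-1); apply: gt0_ler_poweR.
- by rewrite invr_ge0 ltW.
- by rewrite in_itv/= leey andbT; apply: esum_ge0 => i _; exact: poweR_ge0.
- by rewrite in_itv/= leey lee01.
apply: ge_ereal_sup => _ [X [finX _] <-]; rewrite fsbig_finite//=.
apply: (@le_trans _ _ (\sum_(j <- fset_set X)
    ((j \in box_sites (N + n))%:R / vol (N + n)))%:E).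
  rewrite -sumEFin; apply: lee_sum => j _;
    rewrite -(fineK (oscGfin j)) poweR_EFin lee_fin.
  have [jN|jN] := boolP (j \in _).
    rewrite mul1r -cq ge0_ler_powR ?nnegrE ?(ltW q0) ?(ltW c0)//.
      by rewrite fine_ge0 ?osc_ge0.
    by rewrite -lee_fin fineK.
  rewrite (osc_outside GN) ?mul0r ?powR0 ?gt_eqF//=.
  by move=> Nj; move/negP: jN; apply; rewrite mem_box_sites mem_set.
rewrite -mulr_suml lee_fin ler_pdivrMr ?vol_gt0// mul1r -natr_sum ler_nat.
rewrite -big_mkcond sum1_count -size_filter; apply: uniq_leq_size.
  by rewrite filter_uniq// fset_uniq.
by move=> j; rewrite mem_filter => /andP[].
Qed.

(** The rescaled shift sum is the test function. Its factor and the normalization multiply to one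
    full volume of [box (N + n)], while invariance contributes [vol N] copies of the integral of
    [f]. *)
Lemma DLoc_ge n N (r : R) (f : Omega d S -> R) : 1 <= r ->
  Loc (box n) f -> bounded_measurable f -> (osc_norm 1 f <= 1)%E ->
  (((\int[nu]_s f s - \int[mu]_s f s) * (vol N / vol (N + n)))%:E <=
    DLoc r%:E (@box d (N + n)) nu mu / (vol (N + n) `^ r^-1)%:E)%E.
Proof.
move=> r1 fn bf f1; set M := vol (N + n); have M0 : 0 < M by exact: vol_gt0.
set c := (M `^ (1 - r^-1))^-1.
have bt i : bounded_measurable (fun s : Omega d S => f (tau i s)).
  exact: bounded_measurable_comp (measurable_tau i) bf.
have bF : bounded_measurable (shift_sum N f) by exact: bounded_measurable_sum.
have EF (P : probability (Omega d S) R) : translation_invariant P ->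
    \int[P]_s (c * shift_sum N f s) = c * (vol N * \int[P]_s f s).
  move=> P_inv; rewrite prob_RintegralZ// prob_Rintegral_sum//; congr (_ * _).
  rewrite /vol -sum1_size natr_sum mulr_suml; apply: eq_bigr => i _.
  by rewrite Rintegral_tau// mul1r.
have w0 : 0 < M `^ r^-1 by exact: powR_gt0.
rewrite inver (gt_eqF w0) lee_pdivlMr// -EFinM.
apply: (@le_trans _ _ (\int[nu]_s (c * shift_sum N f s) - \int[mu]_s (c *
  shift_sum N f s))%:E).
  rewrite !EF// lee_fin -!mulrBr le_eqVlt; apply/orP; left; apply/eqP.
  have -> : M `^ r^-1 = M * c.
    rewrite /c -powRN -[X in X * _]powRr1 ?ltW// -powRD;
      last by rewrite (gt_eqF M0) implybT.
    by congr (_ `^ _); rewrite opprB addrC subrK.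
  by field; rewrite gt_eqF.
apply: le_DLoc.
- move=> s t st; congr (_ * _); rewrite /shift_sum !big_seq.
  apply: eq_bigr => i; rewrite mem_box_sites => /set_mem Ni; apply: fn.
  by apply: agree_tau Ni _; rewrite addnC.
- exact: bounded_measurableZ.
- exact: osc_norm_shift_sum.
Qed.

End LowerBound.

(** * Conclusion *)

Section Conclusion.
Context {d : nat} {S : pointedType} {R : realType}.
Variables nu mu : probability (Omega d S) R.
Hypothesis finS : finite_set [set: S].
Hypothesis nu_inv : translation_invariant nu.
Hypothesis mu_inv : translation_invariant mu.

Lemma Dy_le_coupling (Pi : probability (Omega d S * Omega d S)%type R) :
  invariant_coupling nu mu Pi -> (D +oo nu mu <= Pi (differ 0%R))%E.
Proof.
move=> cPi; rewrite Dy_sup; apply: ge_ereal_sup => _ [n _ <-].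
apply: (le_trans (DLoc_coupling finS cPi n (leey 1))).
by rewrite mulr1 fineK// fin_num_measure//; exact: measurable_differ.
Qed.

Lemma Dy_dbar : D +oo%E nu mu = dbar nu mu.
Proof.
apply/eqP; rewrite eq_le; apply/andP; split.
  by apply: le_ereal_inf_tmp => _ [Pi cPi <-]; exact: Dy_le_coupling.
have [Pi cPi PiD] := optimal_coupling finS nu_inv mu_inv.
by apply: le_trans PiD; apply: ereal_inf_lbound; exists Pi.
Qed.

(** The normalized discrepancies are squeezed: an optimal coupling bounds them by [Dy] from above,
    and shift sums of a nearly optimal function for [D +oo] bring them within any [eps] of it from
    below. *)
Lemma D_fin_Dy (r : R) : 1 <= r -> D r%:E nu mu = D +oo%E nu mu.
Proof.
move=> r1; set Dy := D +oo%E nu mu;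
  have Dyf : Dy \is a fin_num := Dy_fin_num nu mu.
have [Pi cPi PiD] := optimal_coupling finS nu_inv mu_inv.
pose u n := (DLoc r%:E (@box d n) nu mu / ((size (@box_sites d n))%:R `^
  r^-1)%:E)%E.
have u_le n : (u n <= Dy)%E.
  have w0 : 0 < (size (@box_sites d n))%:R `^ r^-1 :> R by apply: powR_gt0;
    exact: vol_gt0.
  rewrite /u inver (gt_eqF w0) lee_pdivrMr//.
  have r1' : (1 <= r%:E)%E by rewrite lee_fin.
  apply: (le_trans (DLoc_coupling finS cPi n r1')).
  rewrite EFinM lee_wpmul2r// ?lee_fin ?(ltW w0)//.
  by rewrite fineK// fin_num_measure//; exact: measurable_differ.
have u_ge (eps : R) : 0 < eps -> \forall n \near \oo, ((fine Dy - eps)%:E <= u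
  n)%E.
  move=> eps0; have : ((fine Dy - eps)%:E < Dy)%E.
    by rewrite -[ltRHS]fineK // lte_fin ltrBlDr ltrDl.
  rewrite {2}/Dy Dy_sup => /ereal_sup_gt[_ [n _ <-]] /ereal_sup_gt[_ [f [fn f1]
    <-]].
  rewrite hoelder_conjugatey in f1.
  have f1' : (osc_norm (hoelder_conjugate +oo) f <= 1)%E by rewrite
    hoelder_conjugatey.
  have [a fa _] := osc_norm_box (leey 1) fn f1'.
  have bf : bounded_measurable f.
    by apply: (Loc_bounded_measurable (a := a) fn) => i; rewrite fa.
  rewrite !integral_EFin// -EFinB lte_fin; set x := (X in _ < X) => x_gt.
  have : x * ((size (@box_sites d N))%:R / (size (@box_sites d (N + n)))%:R)
    @[N --> \oo] --> x.
    rewrite -[X in _ --> X]mulr1; apply: cvgM; first exact: cvg_cst.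
    exact: vol_ratio_cvg.
  move=> /cvgr_gt/(_ _ x_gt)[K _ HK].
  (* A large box of radius [m] is read as radius [(m - n) + n], with the averaging done over
     [box (m - n)]. *)
  exists (K + n)%N => // m /= Km.
  have nm : (n <= m)%N by rewrite (leq_trans _ Km)// leq_addl.
  have /HK : (K <= m - n)%N by rewrite leq_subRL// addnC.
  rewrite subnK//= => /ltW xm; rewrite -(subnK nm).
  apply: le_trans (DLoc_ge nu_inv mu_inv _ r1 fn bf f1).
  by rewrite lee_fin subnK.
have u_cvg : u n @[n --> \oo] --> Dy.
  rewrite -(fineK Dyf); apply/fine_cvgP.
  have u_fin : \forall n \near \oo, u n \is a fin_num.
    near=> n; rewrite fin_numElt; apply/andP; split.
      by apply: (@lt_le_trans _ _ ((fine Dy - 1)%:E)); [exact: ltNyr|near: n;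
        exact: u_ge].
    by rewrite (le_lt_trans (u_le n))// ltey_eq Dyf.
  split => //; apply/cvgrPdist_le => eps eps0; near=> n.
  have un : u n \is a fin_num by near: n.
  have : ((fine Dy - eps)%:E <= u n)%E by near: n; exact: u_ge.
  have := u_le n; rewrite -{1}(fineK un) -{1}(fineK Dyf) lee_fin => h1.
  rewrite -{1}(fineK un) lee_fin => h2 /=.
  by rewrite ler_norml; apply/andP; split; lra.
exact/cvg_lim.
Unshelve. all: by end_near. Qed.

End Conclusion.

Local Open Scope ereal_scope.

Theorem theorem5p2 (R : realType) (S : pointedType) (d : nat)
    (finS : finite_set [set: S]) (d_gt0 : (0 < d)%N)
    (mu nu : probability (Omega d S) R)
    (mu_inv : translation_invariant mu) (nu_inv : translation_invariant nu) :
  (forall p : \bar R, 1 <= p -> D p nu mu >= D +oo nu mu) /\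
  (forall p : \bar R, 1 <= p ->
     D p nu mu = D +oo nu mu /\ D +oo nu mu = dbar nu mu).
Proof.
have DE p : 1 <= p -> D p nu mu = D +oo nu mu.
  case: p => [r||//]; first by rewrite lee_fin; exact: D_fin_Dy.
  by [].
split => p p1; first by rewrite DE.
by split; [exact: DE|exact: Dy_dbar].
Qed.
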